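(* Let $\phi$ be a generic cubic birational map of $\mathbb{P}^2_\mathbb{C}$, i.e. $\phi=\ell\,\Phi_{a,b}\,\ell'$ with $\ell,\ell'\in\mathrm{Aut}(\mathbb{P}^2_\mathbb{C})$ and $a,b\in\mathbb{C}$ satisfying $a^2\neq 4$ and $2b\notin\{a\pm\sqrt{a^2-4}\}$. Let $\mathcal{F}$ be a foliation of degree $2$ on $\mathbb{P}^2_\mathbb{C}$ numerically invariant under the action of $\phi$, i.e. $\deg\phi^*\mathcal{F}=2$. Then: (1) $\mathcal{F}$ is given by a closed rational $1$-form; (2) $\mathcal{F}$ is non-primitive, i.e. there exists a birational map $\varphi$ of $\mathbb{P}^2_\mathbb{C}$ such that $\deg\varphi^*\mathcal{F}<\deg\mathcal{F}=2$.
   Context: A (singular holomorphic) foliation of degree $d$ on $\mathbb{P}^2_\mathbb{C}$ is given, in homogeneous coordinates $(x:y:z)$, by a $1$-form $\omega=A\,\mathrm{d}x+B\,\mathrm{d}y+C\,\mathrm{d}z$ with $A,B,C$ homogeneous polynomials of degree $d+1$ without common factor and $xA+yB+zC=0$. A birational map $\phi=(\phi_0:\phi_1:\phi_2)$ of $\mathbb{P}^2_\mathbb{C}$, with $\phi_i$ homogeneous of the same degree $k$ without common factor, has degree $k$. The foliation $\phi^*\mathcal{F}$ is the one defined by $\phi^*\omega$ after dividing its coefficients by their greatest common divisor. For $a,b\in\mathbb{C}$ with $a^2\neq4$ and $2b\notin\{a\pm\sqrt{a^2-4}\}$, $$\Phi_{a,b}\colon(x:y:z)\dashrightarrow\big(x(x^2+y^2+axy+bxz+yz):y(x^2+y^2+axy+bxz+yz):xyz\big),$$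 a cubic birational map; the set of all $\ell\,\Phi_{a,b}\,\ell'$ is dense in the set of cubic birational maps, which is the meaning of ''generic''. $\mathcal{F}$ is given by a closed rational $1$-form if there is a nonzero rational $1$-form $\theta$ on $\mathbb{P}^2_\mathbb{C}$ with $\mathrm{d}\theta=0$ defining $\mathcal{F}$. *)

(* Defs.v *)
From mathcomp Require Import all_boot all_order all_algebra.
From mathcomp Require Import reals complex mpoly.

Set Implicit Arguments.
Unset Strict Implicit.
Unset Printing Implicit Defensive.

Import GRing.Theory Num.Theory.

Local Open Scope ring_scope.

(* The homogeneous coordinates (x : y : z) are the variables 'X_0, 'X_1, 'X_2
   of {mpoly C[3]}. A triple of polynomials stands for the polynomial map of
   C^3 with these components, or for the 1-form A dx + B dy + C dz. *)
Definition triple (C : fieldType) := 3.-tuple {mpoly C[3]}.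

(* The zero polynomial is divisible by everything, so this excludes (0,0,0). *)
Definition no_common_factor (C : fieldType) (p : triple C) : Prop :=
  forall g : {mpoly C[3]},
    (forall i, exists q : {mpoly C[3]}, tnth p i = q * g) ->
    g \is a GRing.unit.

Record foliation (C : fieldType) := Foliation {
  fol_deg : nat;
  fol_form : triple C;
  fol_homog : forall i, tnth fol_form i \is (fol_deg.+1).-homog;
  fol_coprime : no_common_factor fol_form;
  fol_euler : \sum_(i < 3) 'X_i * tnth fol_form i = 0
}.

Record rational_map (C : fieldType) := RationalMap {
  rat_deg : nat;
  rat_coord :> triple C;
  rat_homog : forall i, tnth rat_coord i \is rat_deg.-homog;
  rat_coprime : no_common_factor rat_coord
}.

Definition comp_triple (C : fieldType) (p q : triple C) : triple C :=
  [tuple tnth p i \mPo q | i < 3].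

Definition proj_identity (C : fieldType) (p : triple C) : Prop :=
  exists2 h : {mpoly C[3]}, h != 0 & forall i, tnth p i = h * 'X_i.

Definition birational (C : fieldType) (phi : rational_map C) : Prop :=
  exists psi : rational_map C,
    proj_identity (comp_triple psi phi) /\ proj_identity (comp_triple phi psi).

Definition pullback_form (C : fieldType) (p w : triple C) : triple C :=
  [tuple \sum_(i < 3) (tnth w i \mPo p) * (tnth p i)^`M(j) | j < 3].

(* G is the foliation phi^*F. As the coefficients of G have no common factor,
   g is the greatest common divisor of the coefficients of phi^*omega; thus
   G is determined up to a nonzero constant, and fol_deg G is deg phi^*F. *)
Definition is_pullback (C : fieldType) (phi : rational_map C)
    (F G : foliation C) : Prop :=
  exists2 g : {mpoly C[3]}, g != 0 &
    forall j, tnth (pullback_form phi (fol_form F)) j = g * tnth (fol_form G) j.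

Definition linear_triple (C : fieldType) (l : 'M[C]_3) : triple C :=
  [tuple \sum_(j < 3) l i j *: 'X_j | i < 3].

Definition Phi (C : fieldType) (a b : C) : triple C :=
  let x : {mpoly C[3]} := 'X_0 in
  let y : {mpoly C[3]} := 'X_1 in
  let z : {mpoly C[3]} := 'X_2 in
  let q := x ^+ 2 + y ^+ 2 + a *: (x * y) + b *: (x * z) + y * z in
  [tuple x * q; y * q; x * y * z].

(* The rational 1-form sum_i (rform_num i / rform_den) dx_i on P^2, with its
   coefficients reduced to a common denominator. A rational 1-form on C^3 is
   the pull-back of one on P^2 exactly when its coefficients are homogeneous
   of degree -1 and its contraction with the Euler field vanishes. *)
Record rational_form (C : fieldType) := RationalForm {
  rform_deg : nat;
  rform_num : triple C;
  rform_den : {mpoly C[3]};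
  rform_num_homog : forall i, tnth rform_num i \is rform_deg.-homog;
  rform_den_homog : rform_den \is (rform_deg.+1).-homog;
  rform_den_neq0 : rform_den != 0;
  rform_euler : \sum_(i < 3) 'X_i * tnth rform_num i = 0
}.

Definition rform_nonzero (C : fieldType) (theta : rational_form C) : Prop :=
  exists i, tnth (rform_num theta) i != 0.

(* d theta = 0, that is d_j (P_i / Q) = d_i (P_j / Q) by the quotient rule,
   after clearing the common denominator Q ^+ 2. *)
Definition rform_closed (C : fieldType) (theta : rational_form C) : Prop :=
  let P i := tnth (rform_num theta) i in
  let Q := rform_den theta in
  forall i j, (P i)^`M(j) * Q - P i * Q^`M(j) = (P j)^`M(i) * Q - P j * Q^`M(i).

(* theta /\ omega = 0; for theta nonzero this says that theta is a rational
   multiple of omega. *)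
Definition rform_defines (C : fieldType) (theta : rational_form C)
    (F : foliation C) : Prop :=
  forall i j, tnth (rform_num theta) i * tnth (fol_form F) j =
              tnth (rform_num theta) j * tnth (fol_form F) i.

(* Main.v *)
(** Write [x, y, z] for the coordinates, [c, d] for the roots of
   [t^2 + a t + 1] and [q] for the quadratic form occurring in [Phi]. Then
   [Phi] contracts the lines [x = 0], [y = 0], [y = c x], [y = d x] and the
   conic [q = 0] to five distinct points, and has a birational inverse [Psi]
   with [Psi o Phi = x y u q^2 id], [u = (y - c x)(y - d x)]. Pulling back by
   [Psi] shows that the common factor [g] of the coefficients of
   [Phi^* omega], of degree 11 - 3 = 8, is a product of powers of the
   equations of the contracted curves. A local computation bounds each
   exponent by 2; an exponent at least 1 forces omega to vanish at the image
   point, and an exponent equal to 2 forces its linear part there to be radial.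

   If the conic has exponent 2 and the four lines exponent 1, then the
   contraction of omega with the radial field at (0 : 0 : 1) is a binary cubic
   with four zeros, hence zero, and omega has a common factor. In all other
   cases there are three non-collinear image points with exponents at least
   2, 2 and 1. Moving them to the vertices of the coordinate triangle, omega
   becomes [y z M dx + x z N dy - x y (M + N) dz] with [M = p1 y + p2 z] and
   [N = q1 x + q2 z]. Then [omega / (x y M N)] is closed, and the standard
   quadratic involution lowers the degree of the foliation. *)

Require Import Defs.
From mathcomp Require Import all_boot all_order all_algebra.
From mathcomp Require Import reals complex mpoly ring.

Set Implicit Arguments.
Unset Strict Implicit.
Unset Printing Implicit Defensive.

Import GRing.Theory Num.Theory.

Local Open Scope ring_scope.

(** * Composition and pull-back of polynomial maps and forms *)

(** The condition on [a] says [c != d]: the four contracted lines are distinct. The condition on [b]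
    says that [b + c] and [b + d] are nonzero. Their product is [1 - a * b + b ^+ 2], so the conic
    is irreducible; moreover the images of [y = c x] and [y = d x] stay away from (0 : 0 : 1), the
    image of the conic. Factorisation is handled without gcds: a few explicit polynomials are shown
    to be prime, and coprimality of the coefficients of omega does the rest. Both composites of
    [Phi] and [Psi] are needed: [Phi o Psi] confines the factors of [g o Psi], and [Psi o Phi]
    brings [g] itself back. The local bound comes from expanding omega in powers of the equation of
    the contracted curve. Each leading term is a binary form in the direction from which the image
    point is approached. This direction takes all but finitely many values along the curve, so the
    form vanishes identically. *)

Lemma sum3 (V : nmodType) (F : 'I_3 -> V) : \sum_(i < 3) F i = F 0 + F 1 + F 2.
Proof.
rewrite !big_ord_recl big_ord0 addr0 addrA.
by congr (_ + F _ + F _); apply: val_inj.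
Qed.

Lemma ord3_ind (P : 'I_3 -> Prop) : P 0 -> P 1 -> P 2 -> forall i, P i.
Proof.
move=> P0 P1 P2 [[|[|[|//]]] Hi].
- by rewrite (_ : Ordinal Hi = 0) //; apply: val_inj.
- by rewrite (_ : Ordinal Hi = 1) //; apply: val_inj.
- by rewrite (_ : Ordinal Hi = 2) //; apply: val_inj.
Qed.

Definition dvd (C : fieldType) (g p : {mpoly C[3]}) := exists q, p = q * g.

Lemma dvd_mull (C : fieldType) (g p q : {mpoly C[3]}) : dvd g p -> dvd g (q * p).
Proof. by case=> r ->; exists (q * r); rewrite mulrA. Qed.

Lemma dvd_mulr (C : fieldType) (g p q : {mpoly C[3]}) : dvd g p -> dvd g (p * q).
Proof. by rewrite mulrC; apply: dvd_mull. Qed.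

Lemma dvd_refl (C : fieldType) (g : {mpoly C[3]}) : dvd g g.
Proof. by exists 1; rewrite mul1r. Qed.

Lemma dvd_trans (C : fieldType) (g p q : {mpoly C[3]}) :
  dvd g p -> dvd p q -> dvd g q.
Proof. by case=> r -> [s ->]; exists (s * r); rewrite mulrA. Qed.

Lemma dvdD (C : fieldType) (g p q : {mpoly C[3]}) :
  dvd g p -> dvd g q -> dvd g (p + q).
Proof. by case=> r -> [s ->]; exists (r + s); rewrite mulrDl. Qed.

Lemma dvdN (C : fieldType) (g p : {mpoly C[3]}) : dvd g p -> dvd g (- p).
Proof. by case=> r ->; exists (- r); rewrite mulNr. Qed.

Lemma dvdB (C : fieldType) (g p q : {mpoly C[3]}) :
  dvd g p -> dvd g q -> dvd g (p - q).
Proof. by move=> gp gq; apply: dvdD => //; apply: dvdN. Qed.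

Lemma dvd0 (C : fieldType) (g : {mpoly C[3]}) : dvd g 0.
Proof. by exists 0; rewrite mul0r. Qed.

Lemma meval_dvd0 (C : fieldType) (g p : {mpoly C[3]}) (s : 'I_3 -> C) :
  dvd g p -> g.@[s] = 0 -> p.@[s] = 0.
Proof. by case=> q -> gs; rewrite mevalM gs mulr0. Qed.

Lemma tnth_comp_triple (C : fieldType) (p q : triple C) i :
  tnth (comp_triple p q) i = tnth p i \mPo q.
Proof. by rewrite tnth_mktuple. Qed.

Lemma comp_mpolyU (C : fieldType) (q : triple C) i : 'X_i \mPo q = tnth q i.
Proof. by rewrite comp_mpolyXU (tnth_nth 0). Qed.

Lemma comp_mpolyA (C : fieldType) (p : {mpoly C[3]}) (q r : triple C) :
  (p \mPo q) \mPo r = p \mPo comp_triple q r.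
Proof.
elim/mpolyind: p => [|c m p _ _ IH]; first by rewrite !comp_mpoly0.
rewrite !comp_mpolyD !comp_mpolyZ IH !comp_mpolyX rmorph_prod /=.
congr (c *: _ + _); apply: eq_bigr => i _.
by rewrite rmorphXn /= tnth_comp_triple.
Qed.

Lemma comp_tripleA (C : fieldType) (p q r : triple C) :
  comp_triple (comp_triple p q) r = comp_triple p (comp_triple q r).
Proof.
by apply: eq_from_tnth => i; rewrite !tnth_comp_triple comp_mpolyA.
Qed.

Lemma mpoly_ind3 (C : fieldType) (P : {mpoly C[3]} -> Prop) :
  (forall c, P c%:MP) -> (forall i, P 'X_i) ->
  (forall p q, P p -> P q -> P (p + q)) ->
  (forall p q, P p -> P q -> P (p * q)) -> forall p, P p.
Proof.
move=> PC PX PD PM p; elim/mpolyind: p => [|c m p _ _ IH]; first by rewrite -(mpolyC0 3).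
apply: (PD) => //; rewrite -mul_mpolyC; apply: (PM) => //.
rewrite mpolyXE_id; apply: big_ind => [|q r|i _]; [by rewrite -mpolyC1; apply: PC|exact: PM|].
elim: (m i) => [|k IHk]; first by rewrite expr0 -mpolyC1; apply: PC.
by rewrite exprS; apply: PM.
Qed.

Lemma mderivU (C : fieldType) (i j : 'I_3) :
  ('X_i : {mpoly C[3]})^`M(j) = (i == j)%:R.
Proof.
rewrite mderivX mnm1E; case: eqP => [<-|_]; last by rewrite scale0r.
by rewrite scale1r -[RHS]mpolyX0; congr mpolyX; apply/mnmP => k; rewrite mnmBE subnn mnm0E.
Qed.

Lemma mderiv_comp (C : fieldType) (p : {mpoly C[3]}) (q : triple C) j :
  (p \mPo q)^`M(j) = \sum_(i < 3) (p^`M(i) \mPo q) * (tnth q i)^`M(j).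
Proof.
move: p; apply: mpoly_ind3 => [c|i|p r IHp IHr|p r IHp IHr].
- rewrite comp_mpolyC mderivC big1 // => i _.
  by rewrite mderivC comp_mpoly0 mul0r.
- rewrite comp_mpolyU (bigD1 i) //= big1 => [|k ki].
    by rewrite addr0 mderivU eqxx comp_mpoly1 mul1r.
  by rewrite mderivU eq_sym (negPf ki) comp_mpoly0 mul0r.
- rewrite comp_mpolyD mderivD IHp IHr -big_split; apply: eq_bigr => i _ /=.
  by rewrite mderivD comp_mpolyD mulrDl.
- rewrite rmorphM /= mderivM IHp IHr mulr_suml mulr_sumr -big_split.
  apply: eq_bigr => i _ /=; rewrite mderivM comp_mpolyD !rmorphM /=; ring.
Qed.

Lemma tnth_pullback (C : fieldType) (p w : triple C) j :
  tnth (pullback_form p w) j = \sum_(i < 3) (tnth w i \mPo p) * (tnth p i)^`M(j).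
Proof. by rewrite tnth_mktuple. Qed.

Lemma pullback_comp (C : fieldType) (p q w : triple C) :
  pullback_form (comp_triple p q) w = pullback_form q (pullback_form p w).
Proof.
apply: eq_from_tnth => j; rewrite !tnth_pullback.
under [RHS]eq_bigr => i _ do rewrite tnth_pullback rmorph_sum mulr_suml.
rewrite exchange_big /=; apply: eq_bigr => i _.
rewrite !tnth_comp_triple mderiv_comp mulr_sumr; apply: eq_bigr => k _.
by rewrite rmorphM /= comp_mpolyA mulrA.
Qed.

Lemma pullbackZ (C : fieldType) (p w e : triple C) (g : {mpoly C[3]}) :
  (forall j, tnth w j = g * tnth e j) ->
  forall j, tnth (pullback_form p w) j = (g \mPo p) * tnth (pullback_form p e) j.
Proof.
move=> we j; rewrite !tnth_pullback mulr_sumr; apply: eq_bigr => i _.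
by rewrite we rmorphM /= mulrA.
Qed.

Lemma comp_homog (C : fieldType) (p : {mpoly C[3]}) (q : triple C) d k :
  p \is d.-homog -> (forall i, tnth q i \is k.-homog) -> p \mPo q \is (k * d).-homog.
Proof.
move=> /dhomogP pd qk; rewrite comp_mpolyEX big_seq.
apply: rpred_sum => m /pd /= <-; apply: rpredZ; rewrite comp_mpolyX mdegE big_distrr /=.
by elim/big_ind2: _ => [|x1 x2 y1 y2|i _]; [exact: dhomog1|exact: dhomogM|exact: dhomogMn].
Qed.

Lemma comp_homog_scale (C : fieldType) (p h : {mpoly C[3]}) (q r : triple C) d :
  p \is d.-homog -> (forall i, tnth r i = h * tnth q i) -> p \mPo r = h ^+ d * (p \mPo q).
Proof.
move=> /dhomogP pd rq; rewrite !comp_mpolyEX mulr_sumr; apply: eq_big_seq => m /pd /= <-.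
rewrite -scalerAr; congr (_ *: _); rewrite !comp_mpolyX mdegE expr_sum -big_split.
by apply: eq_bigr => i _ /=; rewrite rq exprMn.
Qed.

(** Multiplication by the homogeneous [e] shifts homogeneous components by [d]. A component of [g]
    of degree other than [k] therefore has product 0 with [e], and is 0. *)
Lemma homog_factor (C : fieldType) (g e w : {mpoly C[3]}) d k :
  e != 0 -> e \is d.-homog -> w \is (k + d).-homog -> w = g * e -> g \is k.-homog.
Proof.
move=> e0 ed wk wge.
have piM p j : pihomog mdeg (j + d) (p * e) = pihomog mdeg j p * e.
  elim/mpolyind: p => [|c m p _ _ IH]; first by rewrite mul0r !pihomog0 mul0r.
  rewrite mulrDl !pihomogD mulrDl IH; congr (_ + _).
  rewrite -scalerAl !linearZ /= -scalerAl; congr (_ *: _).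
  have me : 'X_[m] * e \is (mdeg m + d).-homog by apply: dhomogM; rewrite ?dhomogX.
  rewrite pihomogX; case: eqP => [<-|/eqP mj]; first by rewrite pihomog_dE.
  by rewrite mul0r (pihomog_ne0 _ me) // eqn_add2r.
rewrite (@pihomog_partitionE _ _ mdeg _ g (leqnn _)); apply: rpred_sum => j _.
have [->|jk] := eqVneq (j : nat) k; first exact: pihomogP.
have /eqP : pihomog mdeg j g * e = 0.
  by rewrite -piM -wge (pihomog_ne0 _ wk) // eqn_add2r eq_sym.
by rewrite mulf_eq0 (negPf e0) orbF => /eqP ->; apply: dhomog0.
Qed.

(** * Divisibility and prime elements *)

Definition prime_elt (C : fieldType) (f : {mpoly C[3]}) :=
  f != 0 /\ forall p q, dvd f (p * q) -> dvd f p \/ dvd f q.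

Definition id_triple (C : fieldType) : triple C := [tuple 'X_i | i < 3].

(** Substitution respects congruences modulo [f]. Taking the variables for one of the two triples,
    this reduces a polynomial modulo [f] to its value under a parametrisation of [f = 0]. *)
Lemma dvd_comp_sub (C : fieldType) (f p : {mpoly C[3]}) (s t : triple C) :
  (forall i, dvd f (tnth s i - tnth t i)) -> dvd f ((p \mPo s) - (p \mPo t)).
Proof.
move=> st; move: p; apply: mpoly_ind3 => [c|i|p q IHp IHq|p q IHp IHq].
- by rewrite !comp_mpolyC subrr; apply: dvd0.
- by rewrite !comp_mpolyU.
- by rewrite !comp_mpolyD opprD addrACA; apply: dvdD.
- rewrite !rmorphM /=.
  move: (p \mPo s) (q \mPo s) (p \mPo t) (q \mPo t) IHp IHq => a b c d fac fbd.
  rewrite (_ : a * b - c * d = (a - c) * b + c * (b - d)); last by ring.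
  by apply: dvdD; [apply: dvd_mulr|apply: dvd_mull].
Qed.

(** [f] generates the kernel of a ring morphism into an integral domain. *)
Lemma prime_kernel (C : fieldType) (f : {mpoly C[3]}) (t : triple C) :
  f != 0 -> f \mPo t = 0 -> (forall p, p \mPo t = 0 -> dvd f p) -> prime_elt f.
Proof.
move=> f0 ft kert; split=> // p q [r pqr].
have /eqP : (p \mPo t) * (q \mPo t) = 0.
  by rewrite -rmorphM pqr rmorphM /= ft mulr0.
by rewrite mulf_eq0 => /orP[] /eqP /kert; [left|right].
Qed.

Definition linear_form (C : fieldType) (v : 'I_3 -> C) : {mpoly C[3]} :=
  \sum_(i < 3) v i *: 'X_i.

Lemma linear_form_comp (C : fieldType) (v : 'I_3 -> C) (t : triple C) :
  linear_form v \mPo t = \sum_(i < 3) v i *: tnth t i.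
Proof.
rewrite /linear_form rmorph_sum; apply: eq_bigr => i _ /=.
by rewrite comp_mpolyZ comp_mpolyU.
Qed.

Lemma linear_form_eval (C : fieldType) (v s : 'I_3 -> C) :
  (linear_form v).@[s] = \sum_(i < 3) v i * s i.
Proof.
rewrite /linear_form rmorph_sum; apply: eq_bigr => i _ /=.
by rewrite mevalZ mevalXU.
Qed.

Lemma linear_form_neq0 (C : fieldType) (v : 'I_3 -> C) k :
  v k != 0 -> linear_form v != 0.
Proof.
apply: contraNneq => v0; have := linear_form_eval v (fun i => (i == k)%:R).
rewrite v0 meval0 (bigD1 k) //= eqxx mulr1 big1 ?addr0 => [<- //|i /negPf ->].
by rewrite mulr0.
Qed.

Lemma prime_linear_form (C : fieldType) (v : 'I_3 -> C) k :
  v k != 0 -> prime_elt (linear_form v).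
Proof.
move=> vk; set f := linear_form v.
(* Solves [f = 0] for the variable of index [k]: [t] kills [f] and is congruent to the identity
   modulo [f]. *)
pose t : triple C := [tuple 'X_i - ((i == k)%:R / v k) *: f | i < 3].
apply: (@prime_kernel _ _ t); first exact: linear_form_neq0 vk.
  rewrite linear_form_comp.
  under eq_bigr => i _ do rewrite tnth_mktuple scalerBr.
  rewrite sumrB -/(linear_form v) -/f (bigD1 k) //= big1 ?addr0 => [|i /negPf ->].
    by rewrite eqxx scalerA mul1r divff // scale1r subrr.
  by rewrite mul0r scale0r scaler0.
move=> p pt; rewrite -[p]comp_mpoly_id -[_ \mPo _]subr0 -pt.
apply: dvd_comp_sub => i; rewrite !tnth_mktuple opprB addrCA subrr addr0 -mul_mpolyC.
exact/dvd_mull/dvd_refl.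
Qed.

Lemma prime_X (C : fieldType) (i : 'I_3) : prime_elt ('X_i : {mpoly C[3]}).
Proof.
rewrite (_ : 'X_i = linear_form (fun j => (j == i)%:R)).
  by apply: (@prime_linear_form _ _ i); rewrite eqxx oner_neq0.
rewrite /linear_form (bigD1 i) //= eqxx scale1r big1 ?addr0 // => j /negPf ->.
by rewrite scale0r.
Qed.

Lemma prime_pow_cancel (C : fieldType) (v f p : {mpoly C[3]}) n :
  prime_elt v -> ~ dvd v f -> dvd f (v ^+ n * p) -> dvd f p.
Proof.
case=> v0 vP vf; elim: n => [|n IH]; first by rewrite expr0 mul1r.
case=> s; rewrite exprS -mulrA => vs; apply: IH.
have [|[s' ss']|//] := vP s f; first by rewrite -vs; apply/dvd_mulr/dvd_refl.
exists s'; apply: (mulfI v0); rewrite vs ss'; ring.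
Qed.

(* The zero set of [v * 'X_2 + w] is the closure of the graph of [- w / v],
   parametrised by the substitution t. *)
Lemma prime_graph (C : fieldType) (v w : {mpoly C[3]}) :
  let t := [tuple 'X_0 * v; 'X_1 * v; - w] : triple C in
  prime_elt v -> ~ dvd v w -> v \is 1.-homog -> w \is 2.-homog ->
  v \mPo t = v * v -> w \mPo t = v ^+ 2 * w -> prime_elt (v * 'X_2 + w).
Proof.
move=> t vP vw hv hw vt wt; set f := _ + w.
have vf : ~ dvd v f.
  move=> vf; apply: vw; rewrite (_ : w = f - v * 'X_2); last by rewrite /f; ring.
  by apply: dvdB => //; apply/dvd_mulr/dvd_refl.
have f0 : f != 0 by apply/eqP => f0; apply: vf; rewrite f0; apply: dvd0.
have X1 i : ('X_i : {mpoly C[3]}) \is 1.-homog by rewrite dhomogX /= mdeg1.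
have ht i : tnth t i \is 2.-homog.
  move: i; apply: ord3_ind; rewrite !(tnth_nth 0) /=.
  - exact: (@dhomogM _ _ _ 1 _ 1).
  - exact: (@dhomogM _ _ _ 1 _ 1).
  - by rewrite dhomogN.
apply: (prime_kernel f0 (t := t)).
  rewrite /f rmorphD rmorphM /= vt wt comp_mpolyU (tnth_nth 0) /=; ring.
(* For homogeneous [p], [v ^+ n * p] is the value of [p] at the triple [v * 'X_i], which is
   congruent to [t] modulo [f]. *)
have homP n p : p \is n.-homog -> p \mPo t = 0 -> dvd f p.
  move=> hp pt; apply: (@prime_pow_cancel _ v _ _ n) => //.
  pose vX : triple C := [tuple v * 'X_i | i < 3].
  have -> : v ^+ n * p = p \mPo vX.
    rewrite -{1}[p]comp_mpoly_id; apply/esym/comp_homog_scale => // i.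
    by rewrite !tnth_mktuple.
  rewrite -[_ \mPo _]subr0 -pt; apply: dvd_comp_sub.
  apply: ord3_ind; rewrite !tnth_mktuple !(tnth_nth 0) /=.
  - by rewrite mulrC subrr; apply: dvd0.
  - by rewrite mulrC subrr; apply: dvd0.
  - by rewrite opprK; apply: dvd_refl.
(* As [t] is homogeneous of degree 2, the components of [p] have images of distinct degrees, which
   vanish separately. *)
move=> p pt; set N := mmeasure mdeg p.
have pE := @pihomog_partitionE _ _ mdeg N p (leqnn _).
rewrite pE; apply: big_ind => [||i _]; [exact: dvd0|exact: dvdD|].
apply: (homP i); first exact: pihomogP.
have /(congr1 (pihomog mdeg (2 * i))) := pt.
rewrite pihomog0 {1}pE rmorph_sum linear_sum (bigD1 i) //=.
have hc j : (pihomog mdeg j p) \mPo t \is (2 * j).-homog.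
  by apply: comp_homog => //; apply: pihomogP.
rewrite (pihomog_dE (hc i)) big1 ?addr0 // => j ji.
by rewrite (pihomog_ne0 _ (hc j)) // eqn_mul2l /=.
Qed.

(** [Q] may repeat elements of [P]. When these are prime, the supported polynomials are those whose
    prime factors all belong to [P], up to units. *)
Definition supported (C : fieldType) (P : seq {mpoly C[3]}) f :=
  exists c Q, [/\ c \is a GRing.unit, {subset Q <= P} & f = c * \prod_(p <- Q) p].

Lemma supported_mul (C : fieldType) (P : seq {mpoly C[3]}) f g :
  supported P f -> supported P g -> supported P (f * g).
Proof.
move=> [c [Q [cu QP ->]]] [d [S [du SP ->]]]; exists (c * d), (Q ++ S).
split; first by rewrite unitrM cu.
  by move=> p; rewrite mem_cat => /orP[/QP|/SP].
by rewrite big_cat /=; ring.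
Qed.

Lemma supported1 (C : fieldType) (P : seq {mpoly C[3]}) : supported P 1.
Proof. by exists 1, [::]; rewrite big_nil mulr1; split=> //; rewrite unitr1. Qed.

Lemma supported_mem (C : fieldType) (P : seq {mpoly C[3]}) p :
  p \in P -> supported P p.
Proof.
move=> pP; exists 1, [:: p]; rewrite big_seq1 mul1r; split=> //; first exact: unitr1.
by move=> q; rewrite inE => /eqP ->.
Qed.

Lemma supported_unit (C : fieldType) (P : seq {mpoly C[3]}) p :
  p \is a GRing.unit -> supported P p.
Proof. by move=> pu; exists p, [::]; rewrite big_nil mulr1. Qed.

Lemma supported_exp (C : fieldType) (P : seq {mpoly C[3]}) f n :
  supported P f -> supported P (f ^+ n).
Proof.
move=> Pf; elim: n => [|n IH]; first by rewrite expr0; apply: supported1.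
by rewrite exprS; apply: supported_mul.
Qed.

Lemma comp_unit (C : fieldType) (p : {mpoly C[3]}) (t : triple C) :
  p \is a GRing.unit -> p \mPo t \is a GRing.unit.
Proof. by move=> pu; apply: (rmorph_unit (comp_mpoly t)). Qed.

Lemma supported_comp (C : fieldType) (P S : seq {mpoly C[3]}) (t : triple C) f :
  (forall p, p \in P -> supported S (p \mPo t)) -> supported P f ->
  supported S (f \mPo t).
Proof.
move=> PS [c [Q [cu QP ->]]]; rewrite rmorphM rmorph_prod /=.
apply: supported_mul; first exact/supported_unit/comp_unit.
rewrite big_seq; apply: big_ind => [||p /QP /PS //]; first exact: supported1.
exact: supported_mul.
Qed.

(** A prime factor of [h] divides every [u i * f]. Either it divides [f] and is split off from it,
    or it divides all three [u i] and is cancelled. When [h] is used up, [f] divides all [w i]. *)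
Lemma strip_primes (C : fieldType) (P : seq {mpoly C[3]}) f h (u w : 'I_3 -> {mpoly C[3]}) :
  (forall p, p \in P -> prime_elt p) -> supported P h ->
  (forall i, u i * f = h * w i) ->
  (forall g, (forall i, dvd g (w i)) -> g \is a GRing.unit) -> supported P f.
Proof.
move=> primeP [c [Q [cu QP ->]]] ufw cop.
have {u ufw} [u ufw] : exists u, forall i, u i * f = \prod_(p <- Q) p * w i.
  by exists (fun i => c^-1 * u i) => i; rewrite -mulrA ufw !mulrA mulVr // mul1r.
elim: Q f u QP ufw => [|p Q IH] f u QP ufw.
  apply/supported_unit/cop => i; exists (u i).
  by have := ufw i; rewrite big_nil mul1r.
have QP' : {subset Q <= P} by move=> q qQ; apply: QP; rewrite inE qQ orbT.
have pP : p \in P by apply: QP; rewrite inE eqxx.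
have [p0 pP2] := primeP _ pP.
have step : dvd p f -> supported P f.
  case=> f' ff'; rewrite ff'; apply: supported_mul; last exact: supported_mem.
  apply: (IH f' u) => // i; apply: (mulIf p0).
  by rewrite -mulrA -ff' ufw big_cons; ring.
have puf i : dvd p (u i) \/ dvd p f.
  by apply: pP2; rewrite ufw big_cons -mulrA; apply/dvd_mulr/dvd_refl.
have [[u0 e0]|/step //] := puf 0; have [[u1 e1]|/step //] := puf 1.
have [[u2 e2]|/step //] := puf 2.
have [u' uE] : exists u', forall i, u i = u' i * p.
  exists (fun i => nth 0 [:: u0; u1; u2] i).
  by apply: ord3_ind; rewrite /= ?e0 ?e1 ?e2.
apply: (IH f u') => // i; apply: (mulIf p0).
by have := ufw i; rewrite uE big_cons => H; rewrite mulrAC H; ring.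
Qed.

Lemma unit_mpoly (C : fieldType) (p : {mpoly C[3]}) :
  p \is a GRing.unit -> exists2 c, c != 0 & p = c%:MP.
Proof. by move=> /andP[/eqP pE pu]; exists p@_0; rewrite // -unitfE. Qed.

(** * Ternary cubic forms *)

Definition mon3 i j k : 'X_{1..3} := Multinom [tuple i; j; k].

Definition coef3 (C : fieldType) (p : {mpoly C[3]}) i j k : C := p@_(mon3 i j k).

Lemma mon3P (m : 'X_{1..3}) : m = mon3 (m 0) (m 1) (m 2).
Proof. by apply/mnmP; apply: ord3_ind; rewrite [RHS]mnm_tnth (tnth_nth 0%N). Qed.

Lemma mon3_inj i j k i' j' k' :
  mon3 i j k = mon3 i' j' k' -> [/\ i = i', j = j' & k = k'].
Proof. by case. Qed.

Lemma mpolyX_mon3 (C : fieldType) i j k :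
  'X_0 ^+ i * 'X_1 ^+ j * 'X_2 ^+ k = 'X_[mon3 i j k] :> {mpoly C[3]}.
Proof.
rewrite [RHS]mpolyXE_id !big_ord_recl big_ord0 mulr1 mulrA.
by congr ('X_ _ ^+ _ * 'X_ _ ^+ _ * 'X_ _ ^+ _); apply: val_inj.
Qed.

(** Grouped by powers of [z], the order of the expansion at (0 : 0 : 1). The ring is arbitrary, so
    that the coefficients can be numbers or constant polynomials. *)
Definition cubic (R : comRingType) (c : nat -> nat -> nat -> R) (x y z : R) : R :=
  c 0%N 0%N 3%N * z ^+ 3 + (c 1%N 0%N 2%N * x + c 0%N 1%N 2%N * y) * z ^+ 2
  + (c 2%N 0%N 1%N * x ^+ 2 + c 1%N 1%N 1%N * x * y + c 0%N 2%N 1%N * y ^+ 2) * z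
  + (c 3%N 0%N 0%N * x ^+ 3 + c 2%N 1%N 0%N * x ^+ 2 * y + c 1%N 2%N 0%N * x * y ^+ 2 + c 0%N 3%N 0%N * y ^+ 3).

Definition cubic_exps : seq (nat * nat * nat) :=
  [:: (0, 0, 3); (1, 0, 2); (0, 1, 2); (2, 0, 1); (1, 1, 1); (0, 2, 1);
      (3, 0, 0); (2, 1, 0); (1, 2, 0); (0, 3, 0)]%N.

Lemma cubic_sum (R : comRingType) (c : nat -> nat -> nat -> R) (x y z : R) :
  cubic c x y z = \sum_(t <- cubic_exps)
    c t.1.1 t.1.2 t.2 * (x ^+ t.1.1 * y ^+ t.1.2 * z ^+ t.2).
Proof. by rewrite !big_cons big_nil /cubic /=; ring. Qed.

Lemma rmorph_cubic (R S : comRingType) (f : {rmorphism R -> S}) c x y z :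
  f (cubic c x y z) = cubic (fun i j k => f (c i j k)) (f x) (f y) (f z).
Proof. by rewrite /cubic !(rmorphD, rmorphM, rmorphXn). Qed.

Lemma eq_cubic (R : comRingType) (c c' : nat -> nat -> nat -> R) x y z :
  (forall i j k, c i j k = c' i j k) -> cubic c x y z = cubic c' x y z.
Proof. by move=> cc'; rewrite /cubic !cc'. Qed.

Lemma cubicE (C : fieldType) (p : {mpoly C[3]}) : p \is 3.-homog ->
  p = cubic (fun i j k => (coef3 p i j k)%:MP) 'X_0 'X_1 'X_2.
Proof.
move=> /dhomogP hp; apply/mpolyP => m; rewrite [m]mon3P.
move: (m 0) (m 1) (m 2) => i j k.
rewrite cubic_sum raddf_sum /=.
under eq_bigr => t _ do rewrite mpolyX_mon3 mcoeffCM mcoeffX.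
have [d3|d3] := eqVneq (i + j + k)%N 3%N; last first.
  rewrite big_seq big1 => [|t].
    apply: memN_msupp_eq0; apply: contra d3 => /hp /=.
    by rewrite mdegE !big_ord_recl big_ord0 addn0 addnA => /eqP.
  case: t => [[a b] c] tS; case: eqP => [/mon3_inj [/= ea eb ec]|_]; last by rewrite mulr0.
  by case/eqP: d3; rewrite -ea -eb -ec; apply/eqP; move: tS; rewrite !inE;
     do ![case/orP]; move=> /eqP[-> -> ->].
have tlt : (i, j, k) \in cubic_exps.
  by move: i j k d3 => [|[|[|[|i]]]] [|[|[|[|j]]]] [|[|[|[|k]]]].
rewrite (bigD1_seq _ tlt) //= eqxx mulr1 big1 ?addr0 // => t tne.
case: eqP => [/mon3_inj [a b c]|_]; last by rewrite mulr0.
by case: t a b c tne => [[a b] c] /= -> -> ->; rewrite eqxx.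
Qed.

Lemma coef3_XM0 (C : fieldType) (p : {mpoly C[3]}) j k i :
  coef3 ('X_0 * p) i j k = if i is i'.+1 then coef3 p i' j k else 0.
Proof.
rewrite /coef3 mulrC; case: i => [|i].
  apply: memN_msupp_eq0; rewrite (perm_mem (msuppMX _ _)).
  apply/mapP => -[m _ /(congr1 (fun u : 'X_{1..3} => u (0 : 'I_3)))].
  by rewrite mnmDE mnm1E.
rewrite (_ : mon3 i.+1 j k = (mnm1 (0 : 'I_3)%R + mon3 i j k)%MM) ?mcoeffMX //.
by apply/mnmP; apply: ord3_ind; rewrite mnmDE mnm1E !mnm_tnth !(tnth_nth 0%N) /= ?add0n ?add1n.
Qed.

Lemma coef3_XM1 (C : fieldType) (p : {mpoly C[3]}) i k j :
  coef3 ('X_1 * p) i j k = if j is j'.+1 then coef3 p i j' k else 0.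
Proof.
rewrite /coef3 mulrC; case: j => [|j].
  apply: memN_msupp_eq0; rewrite (perm_mem (msuppMX _ _)).
  apply/mapP => -[m _ /(congr1 (fun u : 'X_{1..3} => u (1 : 'I_3)))].
  by rewrite mnmDE mnm1E.
rewrite (_ : mon3 i j.+1 k = (mnm1 (1 : 'I_3)%R + mon3 i j k)%MM) ?mcoeffMX //.
by apply/mnmP; apply: ord3_ind; rewrite mnmDE mnm1E !mnm_tnth !(tnth_nth 0%N) /= ?add0n ?add1n.
Qed.

Lemma coef3_XM2 (C : fieldType) (p : {mpoly C[3]}) i j k :
  coef3 ('X_2 * p) i j k = if k is k'.+1 then coef3 p i j k' else 0.
Proof.
rewrite /coef3 mulrC; case: k => [|k].
  apply: memN_msupp_eq0; rewrite (perm_mem (msuppMX _ _)).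
  apply/mapP => -[m _ /(congr1 (fun u : 'X_{1..3} => u (2 : 'I_3)))].
  by rewrite mnmDE mnm1E.
rewrite (_ : mon3 i j k.+1 = (mnm1 (2 : 'I_3)%R + mon3 i j k)%MM) ?mcoeffMX //.
by apply/mnmP; apply: ord3_ind; rewrite mnmDE mnm1E !mnm_tnth !(tnth_nth 0%N) /= ?add0n ?add1n.
Qed.

(** The coefficient of [x^i y^j z^k] in the Euler relation. For cubics these relations, with
    [i + j + k = 4], carry all the later coefficient computations. *)
Lemma euler_coef (C : fieldType) (w : triple C) i j k :
  \sum_(l < 3) 'X_l * tnth w l = 0 ->
  (if i is i'.+1 then coef3 (tnth w 0) i' j k else 0)
  + (if j is j'.+1 then coef3 (tnth w 1) i j' k else 0)
  + (if k is k'.+1 then coef3 (tnth w 2) i j k' else 0) = 0.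
Proof.
rewrite sum3 -coef3_XM0 -coef3_XM1 -coef3_XM2 /coef3 -!mcoeffD => ->.
exact: mcoeff0.
Qed.

Lemma cubic_comp (C : fieldType) (p : {mpoly C[3]}) (t : triple C) : p \is 3.-homog ->
  p \mPo t = cubic (fun i j k => (coef3 p i j k)%:MP) (tnth t 0) (tnth t 1) (tnth t 2).
Proof.
move=> /cubicE {1}->.
rewrite (rmorph_cubic (comp_mpoly t)) /= !comp_mpolyU.
by apply: eq_cubic => i j k; rewrite comp_mpolyC.
Qed.

Lemma cubic_eval (C : fieldType) (p : {mpoly C[3]}) (s : 'I_3 -> C) : p \is 3.-homog ->
  p.@[s] = cubic (coef3 p) (s 0) (s 1) (s 2).
Proof.
move=> /cubicE {1}->.
rewrite (rmorph_cubic (meval s)) /= !mevalXU.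
by apply: eq_cubic => i j k; rewrite mevalC.
Qed.

(** Multiplying by ['X - b] for each exceptional value [b] gives a polynomial that vanishes
    everywhere; in characteristic 0 the natural numbers are too many roots. *)
Lemma poly_eq0_cofinite (C : numFieldType) (p : {poly C}) (bad : seq C) :
  (forall x, x \notin bad -> p.[x] = 0) -> p = 0.
Proof.
move=> pbad; pose q := p * \prod_(b <- bad) ('X - b%:P).
have q0 x : q.[x] = 0.
  rewrite hornerM; case: (boolP (x \in bad)) => [xb|/pbad ->]; last by rewrite mul0r.
  by rewrite horner_prod (big_rem x xb) /= hornerXsubC subrr mul0r mulr0.
have /eqP : q = 0.
  apply: (roots_geq_poly_eq0 (rs := [seq i%:R | i <- iota 0 (size q)])).
  - by apply/allP => x _; apply/eqP.
  - by rewrite map_inj_uniq ?iota_uniq // => m n /eqP; rewrite eqr_nat => /eqP.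
  - by rewrite size_map size_iota.
rewrite mulf_eq0 => /orP[/eqP //|]; rewrite prodf_seq_eq0 => /hasP[b _] /=.
by rewrite polyXsubC_eq0.
Qed.

Lemma cubic_poly_eq0 (C : numFieldType) (a b c d : C) (bad : seq C) :
  (forall x, x \notin bad -> a + b * x + c * x ^+ 2 + d * x ^+ 3 = 0) ->
  [/\ a = 0, b = 0, c = 0 & d = 0].
Proof.
move=> H; pose p := Poly [:: a; b; c; d].
have p0 : p = 0.
  apply: (@poly_eq0_cofinite _ _ bad) => x /H <-.
  rewrite horner_Poly /=; ring.
have E i : p`_i = [:: a; b; c; d]`_i by rewrite coef_Poly.
by rewrite p0 in E; split; [have := E 0%N|have := E 1%N|have := E 2%N|have := E 3%N];
  rewrite coef0 /=.
Qed.

(** * Local analysis along a contracted curve *)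

Definition axis (C : fieldType) (k : 'I_3) : 'I_3 -> C := fun i => (i == k)%:R.

Lemma eval_axis (C : fieldType) (p : {mpoly C[3]}) d k : p \is d.-homog ->
  p.@[@axis C k] = p@_(mnm_muln (mnm1 k) d).
Proof.
move=> /dhomogP hp; rewrite mevalE.
have mE m : mdeg m = d -> m != mnm_muln (mnm1 k) d -> exists2 i, i != k & m i != 0%N.
  move=> md mk; apply/exists_inP; apply: contraNT mk.
  rewrite negb_exists_in => /forall_inP m0.
  have m0' i : i != k -> m i = 0%N by move/m0/negbNE/eqP.
  have mkd : m k = d by rewrite -md mdegE (bigD1 k) //= big1 ?addn0.
  apply/eqP/mnmP => i; rewrite mulmnE mnm1E eq_sym.
  by case: eqVneq => [->|/m0' ->]; rewrite ?mul1n.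
case: (boolP (mnm_muln (mnm1 k) d \in msupp p)) => [kp|kp].
  rewrite (bigD1_seq _ kp) //= (_ : \prod_(i < 3) _ = 1); last first.
    rewrite big1 // => i _; rewrite mulmnE mnm1E /axis eq_sym.
    by case: eqVneq => _; rewrite ?expr1n ?mul0n ?expr0.
  rewrite mulr1 -[RHS]addr0; congr (_ + _); apply: big1_seq.
  move=> m /andP[mk mp]; have [i ik mi] := mE m (hp _ mp) mk.
  by rewrite (bigD1 i) //= /axis (negPf ik) expr0n (negPf mi) mul0r mulr0.
rewrite (memN_msupp_eq0 kp) big1_seq // => m /andP[_ mp].
have [i ik mi] := mE m (hp _ mp) (memPn kp _ mp).
by rewrite (bigD1 i) //= /axis (negPf ik) expr0n (negPf mi) mul0r mulr0.
Qed.

Lemma mderiv_homog (C : fieldType) (p : {mpoly C[3]}) d i :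
  p \is d.+1.-homog -> p^`M(i) \is d.-homog.
Proof.
move=> /dhomogP hp; apply/dhomogP => m /=; rewrite mcoeff_msupp mcoeff_mderiv => mp.
have /hp /= : (m + mnm1 i)%MM \in msupp p.
  by rewrite mcoeff_msupp; apply: contraNneq mp => ->; rewrite mul0rn.
by rewrite mdegD mdeg1 addn1 => -[].
Qed.

(** The multiplicity is the exponent of ['X_j] in the monomial before derivation: 3 if [j = k], and
    1 otherwise. *)
Lemma mderiv_eval_axis (C : fieldType) (p : {mpoly C[3]}) k j : p \is 3.-homog ->
  (p^`M(j)).@[@axis C k] = p@_(mnm_muln (mnm1 k) 2 + mnm1 j) *+ ((k == j) * 2).+1.
Proof.
by move=> hp; rewrite (eval_axis _ (mderiv_homog j hp)) mcoeff_mderiv mulmnE mnm1E.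
Qed.

Definition sing (C : fieldType) (w : triple C) (s : 'I_3 -> C) :=
  forall i, (tnth w i).@[s] = 0.

(* The linear part of w at the point s is a multiple of the radial form. *)
Definition sing2 (C : fieldType) (w : triple C) (s : 'I_3 -> C) :=
  sing w s /\
  forall i j, ((tnth w i)^`M(j)).@[s] + ((tnth w j)^`M(i)).@[s] = 0.

(** The data of a foliation of degree 2, as a predicate on triples that linear pull-backs
    preserve. *)
Definition form2 (C : fieldType) (w : triple C) :=
  [/\ forall i, tnth w i \is 3.-homog, no_common_factor w &
      \sum_(i < 3) 'X_i * tnth w i = 0].

(** The Euler relation ties the values of the first two coefficients at (0 : 0 : 1) to the terms in
    [x z^2] and [y z^2] of the third. *)
Lemma sing_axis2 (C : fieldType) (w : triple C) : form2 w ->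
  coef3 (tnth w 2) 1 0 2 = 0 -> coef3 (tnth w 2) 0 1 2 = 0 -> sing w (@axis C 2).
Proof.
case=> hw _ ew c102 c012; apply: ord3_ind; rewrite (eval_axis _ (hw _)).
- have := euler_coef 1 0 3 ew; rewrite c102 !addr0 => <-; congr mcoeff.
  by rewrite [LHS]mon3P !mulmnE !mnm1E.
- have := euler_coef 0 1 3 ew; rewrite c012 add0r addr0 => <-; congr mcoeff.
  by rewrite [LHS]mon3P !mulmnE !mnm1E.
- have := euler_coef 0 0 4 ew; rewrite !add0r => <-; congr mcoeff.
  by rewrite [LHS]mon3P !mulmnE !mnm1E.
Qed.

(** One order further, the Euler relation removes the [x z^2] term of the first coefficient and the
    [y z^2] term of the second, and makes the two crossed terms opposite. The linear part is then a
    multiple of [x dy - y dx]. *)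
Lemma sing2_axis2 (C : fieldType) (w : triple C) : form2 w ->
  coef3 (tnth w 2) 1 0 2 = 0 -> coef3 (tnth w 2) 0 1 2 = 0 ->
  coef3 (tnth w 2) 2 0 1 = 0 -> coef3 (tnth w 2) 1 1 1 = 0 ->
  coef3 (tnth w 2) 0 2 1 = 0 -> sing2 w (@axis C 2).
Proof.
move=> fw c102 c012 c201 c111 c021; split; first exact: sing_axis2.
have [hw _ ew] := fw.
have e103 := euler_coef 1 0 3 ew; rewrite c102 !addr0 in e103.
have e013 := euler_coef 0 1 3 ew; rewrite c012 add0r addr0 in e013.
have e004 := euler_coef 0 0 4 ew; rewrite !add0r in e004.
have e202 := euler_coef 2 0 2 ew; rewrite c201 !addr0 in e202.
have e022 := euler_coef 0 2 2 ew; rewrite c021 add0r addr0 in e022.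
have e112 := euler_coef 1 1 2 ew; rewrite c111 addr0 in e112.
have E i j : ((tnth w i)^`M(j)).@[@axis C 2] =
    coef3 (tnth w i) (j == 0)%R (j == 1)%R (2 + (j == 2)%R)%N *+ ((2 == j)%R * 2).+1.
  have mE : (mnm_muln (mnm1 (2 : 'I_3)%R) 2 + mnm1 j)%MM =
      mon3 (j == 0)%R (j == 1)%R (2 + (j == 2)%R)%N.
    by rewrite [LHS]mon3P !mnmDE !mnm1E.
  by rewrite (mderiv_eval_axis _ _ (hw i)) mE /coef3.
apply: ord3_ind; apply: ord3_ind; rewrite !E /=
  ?(addn0, addn1, mul0n, mul1n) ?(e103, e013, e004, e202, e022, c102, c012)
  ?(mul0rn, addr0, mulr1n) // addrC //.
Qed.

(* In these three lemmas [fj, pj, qj, hj] stand for the j-th partial derivatives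
   of [f, p, q, h], so that the left-hand side is the j-th coefficient of the
   pull-back by [(f p : f q : h)] of the form with coefficients [a, b, c]. *)
Lemma contraction_order1 (R : idomainType) (a b c : nat -> nat -> nat -> R)
    f p q h fj pj qj hj :
  f != 0 -> c 0%N 0%N 3%N = 0 ->
  let A := cubic a (f * p) (f * q) h in let B := cubic b (f * p) (f * q) h in
  let D := cubic c (f * p) (f * q) h in
  f * p * A + f * q * B + h * D = 0 ->
  exists y, A * (fj * p + f * pj) + B * (fj * q + f * qj) + D * hj =
    f * y - h ^+ 3 * fj * (c 1%N 0%N 2%N * p + c 0%N 1%N 2%N * q).
Proof.
move=> f0 c003 A B D e.
pose D' := (c 1%N 0%N 2%N * p + c 0%N 1%N 2%N * q) * h ^+ 2
  + f * (c 2%N 0%N 1%N * p ^+ 2 + c 1%N 1%N 1%N * p * q + c 0%N 2%N 1%N * q ^+ 2) * h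
  + f ^+ 2 * (c 3%N 0%N 0%N * p ^+ 3 + c 2%N 1%N 0%N * p ^+ 2 * q + c 1%N 2%N 0%N * p * q ^+ 2 + c 0%N 3%N 0%N * q ^+ 3).
have DE : D = f * D' by rewrite /D /D' /cubic c003; ring.
(* The Euler relation divided by [f]: it replaces [p * A + q * B], the factor of [fj], by a multiple
   of [D'], so that the leading term involves only the coefficients [c]. *)
have {}e : p * A + q * B = - h * D'.
  by apply: (mulfI f0); apply/eqP; rewrite -subr_eq0 -e DE; apply/eqP; ring.
exists (A * pj + B * qj + D' * hj - h * fj *
  ((c 2%N 0%N 1%N * p ^+ 2 + c 1%N 1%N 1%N * p * q + c 0%N 2%N 1%N * q ^+ 2) * h
  + f * (c 3%N 0%N 0%N * p ^+ 3 + c 2%N 1%N 0%N * p ^+ 2 * q + c 1%N 2%N 0%N * p * q ^+ 2 + c 0%N 3%N 0%N * q ^+ 3))).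
rewrite (_ : _ + _ = fj * (p * A + q * B) + f * (A * pj + B * qj) + D * hj); last by ring.
by rewrite e DE /D'; ring.
Qed.

Lemma contraction_order2 (R : idomainType) (a b c : nat -> nat -> nat -> R)
    f p q h fj pj qj hj :
  f != 0 -> c 0%N 0%N 3%N = 0 -> c 1%N 0%N 2%N = 0 -> c 0%N 1%N 2%N = 0 -> a 0%N 0%N 3%N = 0 -> b 0%N 0%N 3%N = 0 ->
  let A := cubic a (f * p) (f * q) h in let B := cubic b (f * p) (f * q) h in
  let D := cubic c (f * p) (f * q) h in
  f * p * A + f * q * B + h * D = 0 ->
  exists y, A * (fj * p + f * pj) + B * (fj * q + f * qj) + D * hj =
    f * (f * y - h ^+ 2 * fj * (c 2%N 0%N 1%N * p ^+ 2 + c 1%N 1%N 1%N * p * q + c 0%N 2%N 1%N * q ^+ 2)).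
Proof.
move=> f0 c003 c102 c012 a003 b003 A B D e.
pose D' := (c 2%N 0%N 1%N * p ^+ 2 + c 1%N 1%N 1%N * p * q + c 0%N 2%N 1%N * q ^+ 2) * h
  + f * (c 3%N 0%N 0%N * p ^+ 3 + c 2%N 1%N 0%N * p ^+ 2 * q + c 1%N 2%N 0%N * p * q ^+ 2 + c 0%N 3%N 0%N * q ^+ 3).
pose quotient (k : nat -> nat -> nat -> R) := (k 1%N 0%N 2%N * p + k 0%N 1%N 2%N * q) * h ^+ 2
  + f * (k 2%N 0%N 1%N * p ^+ 2 + k 1%N 1%N 1%N * p * q + k 0%N 2%N 1%N * q ^+ 2) * h
  + f ^+ 2 * (k 3%N 0%N 0%N * p ^+ 3 + k 2%N 1%N 0%N * p ^+ 2 * q + k 1%N 2%N 0%N * p * q ^+ 2 + k 0%N 3%N 0%N * q ^+ 3).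
have AE : A = f * quotient a by rewrite /A /quotient /cubic a003; ring.
have BE : B = f * quotient b by rewrite /B /quotient /cubic b003; ring.
have DE : D = f ^+ 2 * D' by rewrite /D /D' /cubic c003 c102 c012; ring.
have {}e : p * A + q * B = - h * f * D'.
  by apply: (mulfI f0); apply/eqP; rewrite -subr_eq0 -e DE; apply/eqP; ring.
exists (quotient a * pj + quotient b * qj + D' * hj - h * fj *
  (c 3%N 0%N 0%N * p ^+ 3 + c 2%N 1%N 0%N * p ^+ 2 * q + c 1%N 2%N 0%N * p * q ^+ 2 + c 0%N 3%N 0%N * q ^+ 3)).
rewrite (_ : _ + _ = fj * (p * A + q * B) + f * (A * pj + B * qj) + D * hj); last by ring.
rewrite e DE AE BE; move: (quotient a) (quotient b) => qa qb; rewrite /D'; ring.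
Qed.

Lemma contraction_order3 (R : idomainType) (a b c : nat -> nat -> nat -> R)
    f p q h fj pj qj hj :
  f != 0 -> c 0%N 0%N 3%N = 0 -> c 1%N 0%N 2%N = 0 -> c 0%N 1%N 2%N = 0 -> a 0%N 0%N 3%N = 0 -> b 0%N 0%N 3%N = 0 ->
  c 2%N 0%N 1%N = 0 -> c 1%N 1%N 1%N = 0 -> c 0%N 2%N 1%N = 0 -> a 1%N 0%N 2%N = 0 -> b 0%N 1%N 2%N = 0 ->
  a 0%N 1%N 2%N = - b 1%N 0%N 2%N ->
  let A := cubic a (f * p) (f * q) h in let B := cubic b (f * p) (f * q) h in
  let D := cubic c (f * p) (f * q) h in
  f * p * A + f * q * B + h * D = 0 ->
  exists y, A * (fj * p + f * pj) + B * (fj * q + f * qj) + D * hj =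
    f ^+ 2 * (f * y + h ^+ 2 * b 1%N 0%N 2%N * (p * qj - q * pj) - h * fj *
  (c 3%N 0%N 0%N * p ^+ 3 + c 2%N 1%N 0%N * p ^+ 2 * q + c 1%N 2%N 0%N * p * q ^+ 2 + c 0%N 3%N 0%N * q ^+ 3)).
Proof.
move=> f0 c003 c102 c012 a003 b003 c201 c111 c021 a102 b012 a012 A B D e.
pose D' := c 3%N 0%N 0%N * p ^+ 3 + c 2%N 1%N 0%N * p ^+ 2 * q + c 1%N 2%N 0%N * p * q ^+ 2 + c 0%N 3%N 0%N * q ^+ 3.
pose quotient (k : nat -> nat -> nat -> R) :=
  (k 2%N 0%N 1%N * p ^+ 2 + k 1%N 1%N 1%N * p * q + k 0%N 2%N 1%N * q ^+ 2) * h
  + f * (k 3%N 0%N 0%N * p ^+ 3 + k 2%N 1%N 0%N * p ^+ 2 * q + k 1%N 2%N 0%N * p * q ^+ 2 + k 0%N 3%N 0%N * q ^+ 3).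
(* The radial linear part, a multiple of [x dy - y dx], is kept apart: it produces the term in
   [p * qj - q * pj]. *)
have AE : A = f * (f * quotient a - b 1%N 0%N 2%N * q * h ^+ 2).
  by rewrite /A /quotient /cubic a003 a102 a012; ring.
have BE : B = f * (f * quotient b + b 1%N 0%N 2%N * p * h ^+ 2).
  by rewrite /B /quotient /cubic b003 b012; ring.
have DE : D = f ^+ 3 * D' by rewrite /D /D' /cubic c003 c102 c012 c201 c111 c021; ring.
have {}e : p * A + q * B = - h * f ^+ 2 * D'.
  by apply: (mulfI f0); apply/eqP; rewrite -subr_eq0 -e DE; apply/eqP; ring.
exists (quotient a * pj + quotient b * qj + D' * hj).
rewrite (_ : _ + _ = fj * (p * A + q * B) + f * (A * pj + B * qj) + D * hj); last by ring.
rewrite e DE AE BE; move: (quotient a) (quotient b) => qa qb; rewrite /D'; ring.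
Qed.

(* The map [(f p : f q : h)] contracts the curve [f = 0] to (0 : 0 : 1); [s] is a
   point of the curve sent to the direction of slope [x], and [t] is a tangent
   vector to the curve along which this slope varies. *)
Definition contraction (C : fieldType) (f p q h : {mpoly C[3]}) :=
  exists bad : seq C, forall x, x \notin bad -> exists s t : 'I_3 -> C,
  [/\ [/\ f.@[s] = 0, p.@[s] != 0, q.@[s] = x * p.@[s] & h.@[s] != 0],
      exists j, f^`M(j).@[s] != 0, \sum_(j < 3) t j * f^`M(j).@[s] = 0 &
      \sum_(j < 3) t j * (p * q^`M(j) - q * p^`M(j)).@[s] != 0].

(** If the third coefficient vanished, the form would be a multiple of [x dy - y dx], the pencil of
    lines through (0 : 0 : 1). Coprimality makes the cofactor constant, so the coefficients would
    have degree 1 instead of 3. *)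
Lemma contact_neq0 (C : fieldType) (w : triple C) : form2 w -> tnth w 2 != 0.
Proof.
move=> [hw cw ew]; apply/eqP => w2.
have X0 i := (prime_X C i).1.
move: ew; rewrite sum3 w2 mulr0 addr0 => ew.
have [//|X01|[k kE]] := (prime_X C 0).2 'X_1 (tnth w 1).
- by exists (- tnth w 0); apply/eqP; rewrite mulNr -addr_eq0 addrC mulrC; apply/eqP; rewrite mulrC [tnth w 0 * _]mulrC.
- have := meval_dvd0 X01 (s := @axis C 1); rewrite !mevalXU /axis /= => /(_ erefl) /eqP.
  by rewrite oner_eq0.
have w0 : tnth w 0 = - ('X_1 * k).
  by apply: (mulfI (X0 0)); apply/eqP; rewrite -subr_eq0 -ew kE; apply/eqP; ring.
have ku : k \is a GRing.unit.
  apply: cw; apply: ord3_ind.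
  - by exists (- 'X_1); rewrite w0 mulNr.
  - by exists 'X_0; rewrite kE mulrC.
  - by exists 0; rewrite w2 mul0r.
have [c c0 kc] := unit_mpoly ku.
have h1 : tnth w 1 \is 1.-homog.
  by rewrite kE kc mul_mpolyC dhomogZ // dhomogX /= mdeg1.
have : tnth w 1 != 0 by rewrite kE kc mulf_neq0 // mpolyC_eq0.
by move/dhomog_uniq => /(_ _ _ _ h1 (hw 1)).
Qed.

Lemma dvd_sub_mul (C : fieldType) (f y e : {mpoly C[3]}) :
  dvd f (f * y - e) -> dvd f e.
Proof.
move=> fye; rewrite (_ : e = f * y - (f * y - e)); last by ring.
by apply: dvdB => //; apply/dvd_mulr/dvd_refl.
Qed.

Lemma dvd_cancel (C : fieldType) (f g p : {mpoly C[3]}) :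
  g != 0 -> dvd (f * g) (g * p) -> dvd f p.
Proof.
by move=> g0 [r e]; exists r; apply: (mulfI g0); rewrite e; ring.
Qed.

(** After division by a power of [f] and evaluation on the curve, a binary form in [p] and [q]
    vanishes at all but finitely many slopes. This kills, one power of [f] at a time, the successive
    terms of the third coefficient of [w]; a factor [f ^+ 3] would kill that coefficient
    altogether. *)
Lemma contraction_mult (C : numFieldType) (w : triple C) (f p q h : {mpoly C[3]}) :
  form2 w -> contraction f p q h ->
  let W := pullback_form [tuple f * p; f * q; h] w in
  [/\ (forall j, dvd f (tnth W j)) -> sing w (@axis C 2),
      (forall j, dvd (f ^+ 2) (tnth W j)) -> sing2 w (@axis C 2) &
      ~ forall j, dvd (f ^+ 3) (tnth W j)].
Proof.
move=> fw [bad con]; have [hw cw ew] := fw.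
set t : triple C := [tuple _; _; _]; move=> W.
(* If [f] were 0, every slope would be exceptional, and the constant 1 would vanish at all slopes
   outside [bad]. *)
have f0 : f != 0.
  apply/eqP => f0; have [] := @cubic_poly_eq0 C 1 0 0 0 bad; last by move/eqP; rewrite oner_eq0.
  by move=> x /con [s [u [_ [j fj] _ _]]]; move: fj; rewrite f0 mderiv0 meval0 eqxx.
pose cf l i j k : {mpoly C[3]} := (coef3 (tnth w l) i j k)%:MP.
have comp l : tnth w l \mPo t = cubic (cf l) (f * p) (f * q) h.
  by rewrite cubic_comp //; congr cubic; rewrite (tnth_nth 0).
have eul : f * p * cubic (cf 0) (f * p) (f * q) h + f * q * cubic (cf 1) (f * p) (f * q) h
    + h * cubic (cf 2) (f * p) (f * q) h = 0.
  have := congr1 (comp_mpoly t) ew.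
  by rewrite sum3 comp_mpoly0 !rmorphD !rmorphM /= !comp_mpolyU !comp !(tnth_nth 0) /=.
have WE j : tnth W j = cubic (cf 0) (f * p) (f * q) h * (f^`M(j) * p + f * p^`M(j))
    + cubic (cf 1) (f * p) (f * q) h * (f^`M(j) * q + f * q^`M(j))
    + cubic (cf 2) (f * p) (f * q) h * h^`M(j).
  by rewrite tnth_pullback sum3 !comp !(tnth_nth 0) /= !mderivM.
have MP0 (c : C) : c = 0 -> c%:MP_[3] = 0 by move->; rewrite mpolyC0.
have c003 : cf 2 0%N 0%N 3%N = 0.
  by apply: MP0; have := euler_coef 0 0 4 ew; rewrite !add0r.
have ord1 : (forall j, dvd f (tnth W j)) ->
    coef3 (tnth w 2) 1 0 2 = 0 /\ coef3 (tnth w 2) 0 1 2 = 0.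
  move=> fW; have [] := @cubic_poly_eq0 C (coef3 (tnth w 2) 1 0 2) (coef3 (tnth w 2) 0 1 2) 0 0 bad => //.
  move=> x /con [s [_ [[fs ps qs hs] [j fj] _ _]]].
  have [y yE] := contraction_order1 (f^`M(j)) (p^`M(j)) (q^`M(j)) (h^`M(j)) f0 c003 eul.
  have := fW j; rewrite WE yE => /dvd_sub_mul /meval_dvd0 /(_ fs).
  rewrite !(mevalM, mevalD, mevalC) ?rmorphXn /= qs => /eqP.
  rewrite !(mulf_eq0, expf_eq0) (negPf hs) (negPf fj) /= => /eqP e.
  by apply: (mulIf ps); rewrite [RHS]mul0r -[RHS]e; ring.
have a003 : (forall j, dvd f (tnth W j)) -> cf 0 0%N 0%N 3%N = 0.
  move=> /ord1 [c102 c012]; apply: MP0.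
  by have := euler_coef 1 0 3 ew; rewrite c102 !addr0.
have b003 : (forall j, dvd f (tnth W j)) -> cf 1 0%N 0%N 3%N = 0.
  move=> /ord1 [c102 c012]; apply: MP0.
  by have := euler_coef 0 1 3 ew; rewrite c012 add0r addr0.
have ord2 : (forall j, dvd (f ^+ 2) (tnth W j)) ->
    [/\ forall j, dvd f (tnth W j), coef3 (tnth w 2) 2 0 1 = 0,
        coef3 (tnth w 2) 1 1 1 = 0 & coef3 (tnth w 2) 0 2 1 = 0].
  move=> f2W.
  have fW j : dvd f (tnth W j).
    by apply: dvd_trans (f2W j); apply/dvd_mulr/dvd_refl.
  have [c102 c012] := ord1 fW.
  have [] := @cubic_poly_eq0 C (coef3 (tnth w 2) 2 0 1) (coef3 (tnth w 2) 1 1 1)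
    (coef3 (tnth w 2) 0 2 1) 0 bad => //.
  move=> x /con [s [_ [[fs ps qs hs] [j fj] _ _]]].
  have [y yE] := contraction_order2 (f^`M(j)) (p^`M(j)) (q^`M(j)) (h^`M(j)) f0 c003
    (MP0 _ c102) (MP0 _ c012) (a003 fW) (b003 fW) eul.
  have := f2W j; rewrite WE yE expr2 => /(dvd_cancel f0) /dvd_sub_mul /meval_dvd0 /(_ fs).
  rewrite !(mevalM, mevalD, mevalC) ?rmorphXn /= ?qs => /eqP.
  rewrite !(mulf_eq0, expf_eq0) (negPf hs) (negPf fj) /= => /eqP e.
  by apply: (mulIf (expf_neq0 2 ps)); rewrite [RHS]mul0r -[RHS]e; ring.
split.
- by move=> /ord1 [? ?]; apply: sing_axis2.
- by move=> /ord2 [/ord1 [? ?] ? ? ?]; apply: sing2_axis2.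
move=> f3W.
have f2W j : dvd (f ^+ 2) (tnth W j).
  by apply: dvd_trans (f3W j); rewrite exprS; apply/dvd_mull/dvd_refl.
have [fW c201 c111 c021] := ord2 f2W.
have [c102 c012] := ord1 fW.
have a102 : coef3 (tnth w 0) 1 0 2 = 0.
  by have := euler_coef 2 0 2 ew; rewrite c201 !addr0.
have b012 : coef3 (tnth w 1) 0 1 2 = 0.
  by have := euler_coef 0 2 2 ew; rewrite c021 add0r addr0.
have a012 : coef3 (tnth w 0) 0 1 2 = - coef3 (tnth w 1) 1 0 2.
  by apply/eqP; rewrite -addr_eq0; have := euler_coef 1 1 2 ew; rewrite c111 addr0 => ->.
pose D : {mpoly C[3]} := cf 2 3%N 0%N 0%N * p ^+ 3 + cf 2 2%N 1%N 0%N * p ^+ 2 * q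
  + cf 2 1%N 2%N 0%N * p * q ^+ 2 + cf 2 0%N 3%N 0%N * q ^+ 3.
have key s j : f.@[s] = 0 -> h.@[s] != 0 ->
    coef3 (tnth w 1) 1 0 2 * h.@[s] * (p * q^`M(j) - q * p^`M(j)).@[s] = f^`M(j).@[s] * D.@[s].
  move=> fs hs.
  have [|y yE] := contraction_order3 (f^`M(j)) (p^`M(j)) (q^`M(j)) (h^`M(j)) f0 c003
    (MP0 _ c102) (MP0 _ c012) (a003 fW) (b003 fW) (MP0 _ c201) (MP0 _ c111) (MP0 _ c021)
    (MP0 _ a102) (MP0 _ b012) _ eul.
    by rewrite /cf a012 mpolyCN.
  have := f3W j; rewrite WE yE exprS => /(dvd_cancel (expf_neq0 2 f0)).
  rewrite -/D -addrA -[X in _ + X]opprB => /dvd_sub_mul /meval_dvd0 /(_ fs).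
  rewrite mevalB !mevalM ?rmorphXn /= mevalC => /eqP; rewrite subr_eq0 => /eqP e.
  by apply: (mulfI hs); rewrite [RHS]mulrA e; ring.
(* Contracting [key] with the tangent vector [u] removes the derivatives of [f], while the slope
   varies along [u]: the radial linear part is zero. *)
have d0 : coef3 (tnth w 1) 1 0 2 = 0.
  have [] := @cubic_poly_eq0 C (coef3 (tnth w 1) 1 0 2) 0 0 0 bad => //.
  move=> x /con [s [u [[fs ps qs hs] _ uf upq]]]; rewrite !mul0r !addr0.
  apply: (mulIf hs); apply: (mulIf upq); rewrite !mul0r mulr_sumr.
  transitivity ((\sum_(j < 3) u j * f^`M(j).@[s]) * D.@[s]); last by rewrite uf mul0r.
  rewrite mulr_suml; apply: eq_bigr => j _.
  by rewrite mulrCA key // mulrA.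
(* With the linear part gone, [key] says that the binary cubic [D] vanishes at almost every
   slope. *)
have [c300 c210 c120 c030] : [/\ coef3 (tnth w 2) 3 0 0 = 0, coef3 (tnth w 2) 2 1 0 = 0,
    coef3 (tnth w 2) 1 2 0 = 0 & coef3 (tnth w 2) 0 3 0 = 0].
  apply: (@cubic_poly_eq0 C _ _ _ _ bad) => x /con [s [_ [[fs ps qs hs] [j fj] _ _]]].
  have := key s j fs hs; rewrite d0 !mul0r => /esym/eqP; rewrite mulf_eq0 (negPf fj) /=.
  rewrite /D !(mevalM, mevalD, mevalC) ?rmorphXn /= ?qs => /eqP e.
  by apply: (mulIf (expf_neq0 3 ps)); rewrite [RHS]mul0r -[RHS]e; ring.
have /eqP := contact_neq0 fw; apply; rewrite (cubicE (hw 2)) /cubic.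
have c003' : coef3 (tnth w 2) 0 0 3 = 0 by have := euler_coef 0 0 4 ew; rewrite !add0r.
rewrite c003' c102 c012 c201 c111 c021 c300 c210 c120 c030 mpolyC0; ring.
Qed.

(** * Linear changes of coordinates *)

Lemma tnth_linear (C : fieldType) (M : 'M[C]_3) i :
  tnth (linear_triple M) i = \sum_(j < 3) M i j *: 'X_j.
Proof. by rewrite tnth_mktuple. Qed.

Lemma linear_homog (C : fieldType) (M : 'M[C]_3) i :
  tnth (linear_triple M) i \is 1.-homog.
Proof.
rewrite tnth_linear; apply: rpred_sum => j _; apply: rpredZ.
by rewrite dhomogX /= mdeg1.
Qed.

Lemma mderiv_linear (C : fieldType) (M : 'M[C]_3) i j :
  (tnth (linear_triple M) i)^`M(j) = (M i j)%:MP.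
Proof.
rewrite tnth_linear raddf_sum (bigD1 j) //= big1 ?addr0 => [|k kj].
  by rewrite mderivZ mderivU eqxx -mul_mpolyC mulr1.
by rewrite mderivZ mderivU (negPf kj) scaler0.
Qed.

Lemma linear_eval (C : fieldType) (M : 'M[C]_3) i (s : 'I_3 -> C) :
  (tnth (linear_triple M) i).@[s] = \sum_(j < 3) M i j * s j.
Proof. by rewrite tnth_linear; apply: linear_form_eval. Qed.

Lemma linear_comp (C : fieldType) (M N : 'M[C]_3) :
  comp_triple (linear_triple M) (linear_triple N) = linear_triple (M *m N).
Proof.
apply: eq_from_tnth => i; rewrite tnth_comp_triple !tnth_linear.
rewrite -/(linear_form (fun j => M i j)) linear_form_comp.
under eq_bigr => j _ do rewrite tnth_linear scaler_sumr.
rewrite exchange_big /=; apply: eq_bigr => k _.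
by rewrite mxE scaler_suml; apply: eq_bigr => j _; rewrite scalerA.
Qed.

Lemma linear1 (C : fieldType) : linear_triple 1%:M = id_triple C.
Proof.
apply: eq_from_tnth => i; rewrite tnth_linear tnth_mktuple (bigD1 i) //=.
rewrite mxE eqxx scale1r big1 ?addr0 // => j ji.
by rewrite mxE eq_sym (negPf ji) scale0r.
Qed.

Lemma comp_id_triple (C : fieldType) (p : triple C) : comp_triple (id_triple C) p = p.
Proof.
by apply: eq_from_tnth => i; rewrite tnth_comp_triple tnth_mktuple comp_mpolyU.
Qed.

Lemma pullback_id (C : fieldType) (w : triple C) : pullback_form (id_triple C) w = w.
Proof.
apply: eq_from_tnth => j; rewrite tnth_pullback (bigD1 j) //= big1 => [|i ij].
  by rewrite tnth_mktuple mderivU eqxx mulr1 addr0 comp_mpoly_id.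
by rewrite tnth_mktuple mderivU (negPf ij) mulr0.
Qed.

Lemma linear_compK (C : fieldType) (M : 'M[C]_3) (p : {mpoly C[3]}) : M \in unitmx ->
  (p \mPo linear_triple M) \mPo linear_triple (invmx M) = p.
Proof. by move=> Mu; rewrite comp_mpolyA linear_comp mulmxV // linear1 comp_mpoly_id. Qed.

Lemma linear_compVK (C : fieldType) (M : 'M[C]_3) (p : {mpoly C[3]}) : M \in unitmx ->
  (p \mPo linear_triple (invmx M)) \mPo linear_triple M = p.
Proof. by move=> Mu; rewrite comp_mpolyA linear_comp mulVmx // linear1 comp_mpoly_id. Qed.

Lemma pullback_linearK (C : fieldType) (M : 'M[C]_3) (w : triple C) : M \in unitmx ->
  pullback_form (linear_triple (invmx M)) (pullback_form (linear_triple M) w) = w.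
Proof. by move=> Mu; rewrite -pullback_comp linear_comp mulmxV // linear1 pullback_id. Qed.

Lemma tnth_pullback_linear (C : fieldType) (M : 'M[C]_3) (w : triple C) j :
  tnth (pullback_form (linear_triple M) w) j =
  \sum_(i < 3) (M i j) *: (tnth w i \mPo linear_triple M).
Proof.
rewrite tnth_pullback; apply: eq_bigr => i _.
by rewrite mderiv_linear mulrC mul_mpolyC.
Qed.

Lemma no_common_factor_comp_linear (C : fieldType) (M : 'M[C]_3) (w : triple C) :
  M \in unitmx -> no_common_factor w -> no_common_factor (comp_triple w (linear_triple M)).
Proof.
move=> Mu cw g gw; rewrite -(linear_compVK g Mu); apply/comp_unit/cw => i.
have [q qE] := gw i; exists (q \mPo linear_triple (invmx M)).
by rewrite -rmorphM /= -qE tnth_comp_triple linear_compK.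
Qed.

Lemma no_common_factor_linear_comb (C : fieldType) (M : 'M[C]_3) (v w : triple C) :
  M \in unitmx -> (forall i, tnth v i = \sum_(j < 3) M i j *: tnth w j) ->
  no_common_factor w -> no_common_factor v.
Proof.
move=> Mu vw cw g gv; apply: cw => k.
have -> : tnth w k = \sum_(i < 3) invmx M k i *: tnth v i.
  have VM l : \sum_(i < 3) invmx M k i * M i l = (k == l)%:R.
    by have := mulVmx Mu => /matrixP /(_ k l); rewrite !mxE.
  under eq_bigr => i _ do rewrite vw scaler_sumr.
  rewrite exchange_big /=.
  have E j : \sum_(i < 3) invmx M k i *: (M i j *: tnth w j) = (k == j)%:R *: tnth w j.
    by rewrite -VM scaler_suml; apply: eq_bigr => i _; rewrite scalerA.
  under eq_bigr => j _ do rewrite E.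
  rewrite (bigD1 k) //= eqxx scale1r big1 ?addr0 // => j.
  by rewrite eq_sym => /negPf ->; rewrite scale0r.
apply: (big_ind (dvd g)) => [||i _]; [exact: dvd0|exact: dvdD|].
by have [q ->] := gv i; exists (invmx M k i *: q); rewrite scalerAl.
Qed.

Lemma form2_linear (C : fieldType) (M : 'M[C]_3) (w : triple C) :
  M \in unitmx -> form2 w -> form2 (pullback_form (linear_triple M) w).
Proof.
move=> Mu [hw cw ew]; split.
- move=> j; rewrite tnth_pullback_linear; apply: rpred_sum => i _; apply: rpredZ.
  exact: (comp_homog (hw i) (linear_homog M)).
- apply: (@no_common_factor_linear_comb _ M^T _ (comp_triple w (linear_triple M))).
  + by rewrite unitmx_tr.
  + move=> j; rewrite tnth_pullback_linear; apply: eq_bigr => i _.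
    by rewrite mxE tnth_comp_triple.
  + exact: no_common_factor_comp_linear.
- transitivity ((\sum_(i < 3) 'X_i * tnth w i) \mPo linear_triple M); last first.
    by rewrite ew comp_mpoly0.
  rewrite rmorph_sum /=; under eq_bigr => j _ do rewrite tnth_pullback_linear mulr_sumr.
  rewrite exchange_big /=; apply: eq_bigr => i _.
  rewrite rmorphM /= comp_mpolyU tnth_linear mulr_suml; apply: eq_bigr => j _.
  by rewrite -scalerAl -scalerAr.
Qed.

Lemma sing_linear (C : fieldType) (M : 'M[C]_3) (w : triple C) (s : 'I_3 -> C) :
  sing w (fun i => \sum_(j < 3) M i j * s j) ->
  sing (pullback_form (linear_triple M) w) s.
Proof.
move=> ws j; rewrite tnth_pullback_linear raddf_sum big1 // => i _ /=.
rewrite mevalZ comp_mpoly_meval (meval_eq _ (v2 := fun i => \sum_(j < 3) M i j * s j)).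
  by rewrite ws mulr0.
by move=> k; rewrite linear_eval.
Qed.

(** The substitution being linear, the Jacobian matrix [d] of the coefficients becomes [M^T d M],
    which is antisymmetric if [d] is. *)
Lemma sing2_linear (C : fieldType) (M : 'M[C]_3) (w : triple C) (s : 'I_3 -> C) :
  sing2 w (fun i => \sum_(j < 3) M i j * s j) ->
  sing2 (pullback_form (linear_triple M) w) s.
Proof.
case=> ws ws2; split; first exact: sing_linear.
pose d i l := ((tnth w i)^`M(l)).@[fun i => \sum_(j < 3) M i j * s j].
have E j k : ((tnth (pullback_form (linear_triple M) w) j)^`M(k)).@[s] =
    \sum_(i < 3) \sum_(l < 3) M i j * M l k * d i l.
  rewrite tnth_pullback_linear (raddf_sum (mderiv k)) (raddf_sum (meval s)); apply: eq_bigr => i _ /=.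
  rewrite mderivZ mevalZ mderiv_comp (raddf_sum (meval s)) mulr_sumr; apply: eq_bigr => l _ /=.
  rewrite mderiv_linear mevalM mevalC comp_mpoly_meval.
  rewrite (meval_eq _ (v2 := fun i => \sum_(j < 3) M i j * s j)) -?/(d i l).
    by rewrite [X in _ * X = _]mulrC mulrA.
  by move=> m; rewrite linear_eval.
move=> j k; rewrite !E [X in _ + X]exchange_big -big_split big1 // => i _ /=.
rewrite -big_split big1 // => l _ /=.
by rewrite [M l k * _]mulrC -mulrDr ws2 mulr0.
Qed.

Lemma sing_linearV (C : fieldType) (M : 'M[C]_3) (w : triple C) k :
  M \in unitmx -> sing (pullback_form (linear_triple M) w) (@axis C k) ->
  sing w (fun i => M i k).
Proof.
move=> Mu ws; rewrite -(pullback_linearK w Mu); apply: sing_linear => i.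
rewrite (meval_eq _ (v2 := @axis C k)) // => j.
by have := mulVmx Mu => /matrixP /(_ j k); rewrite !mxE.
Qed.

Lemma sing2_linearV (C : fieldType) (M : 'M[C]_3) (w : triple C) k :
  M \in unitmx -> sing2 (pullback_form (linear_triple M) w) (@axis C k) ->
  sing2 w (fun i => M i k).
Proof.
move=> Mu ws; rewrite -(pullback_linearK w Mu); apply: sing2_linear.
have E : (fun i => \sum_(j < 3) invmx M i j * M j k) =1 @axis C k.
  by move=> j; have := mulVmx Mu => /matrixP /(_ j k); rewrite !mxE.
case: ws => ws1 ws2; split=> [i|i j]; first by rewrite (meval_eq _ E).
by rewrite !(meval_eq _ E).
Qed.

Lemma sing_col (C : fieldType) (M : 'M[C]_3) (w : triple C) k :
  sing w (fun i => M i k) -> sing (pullback_form (linear_triple M) w) (@axis C k).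
Proof.
move=> ws; apply: sing_linear => i; rewrite (meval_eq _ (v2 := fun i => M i k)) // => j.
by rewrite (bigD1 k) //= /axis eqxx mulr1 big1 ?addr0 // => l /negPf ->; rewrite mulr0.
Qed.

Lemma sing2_col (C : fieldType) (M : 'M[C]_3) (w : triple C) k :
  sing2 w (fun i => M i k) -> sing2 (pullback_form (linear_triple M) w) (@axis C k).
Proof.
move=> [ws ws2]; apply: sing2_linear.
have E : (fun i => \sum_(j < 3) M i j * @axis C k j) =1 (fun i => M i k).
  move=> j; rewrite (bigD1 k) //= /axis eqxx mulr1 big1 ?addr0 // => l /negPf ->.
  by rewrite mulr0.
by split=> [i|i j]; rewrite !(meval_eq _ E).
Qed.

(** Closedness is the symmetry of the matrix [D], and the pull-back replaces [D] by [M^T D M]. *)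
Lemma closed_linear (C : fieldType) (M : 'M[C]_3) (P : triple C) (Q : {mpoly C[3]}) :
  (forall i j, (tnth P i)^`M(j) * Q - tnth P i * Q^`M(j) =
               (tnth P j)^`M(i) * Q - tnth P j * Q^`M(i)) ->
  let P' := pullback_form (linear_triple M) P in let Q' := Q \mPo linear_triple M in
  forall i j, (tnth P' i)^`M(j) * Q' - tnth P' i * Q'^`M(j) =
              (tnth P' j)^`M(i) * Q' - tnth P' j * Q'^`M(i).
Proof.
move=> clo P' Q'.
pose D i j := ((tnth P i)^`M(j) * Q - tnth P i * Q^`M(j)) \mPo linear_triple M.
have E j k : (tnth P' j)^`M(k) * Q' - tnth P' j * Q'^`M(k) =
    \sum_(i < 3) \sum_(l < 3) (M i j * M l k) *: D i l.
  rewrite tnth_pullback_linear raddf_sum !mulr_suml -sumrB; apply: eq_bigr => i _ /=.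
  rewrite mderivZ mderiv_comp /Q' mderiv_comp scaler_sumr mulr_suml mulr_sumr -sumrB.
  apply: eq_bigr => l _; rewrite mderiv_linear /D rmorphB !rmorphM /=.
  by rewrite -!mul_mpolyC mpolyCM; ring.
move=> i j; rewrite !E exchange_big; apply: eq_bigr => l _; apply: eq_bigr => m _.
by rewrite mulrC /D clo.
Qed.

(** * The common factor of the pulled-back form *)

Definition quad_u (R : comRingType) (a x y : R) := x ^+ 2 + y ^+ 2 + a * (x * y).
Definition quad_q (R : comRingType) (a b x y z : R) :=
  x ^+ 2 + y ^+ 2 + a * (x * y) + b * (x * z) + y * z.
Definition quad_r (R : comRingType) (b x y z : R) := x * y - (b * x + y) * z.

Lemma rmorph_quad_u (R S : comRingType) (f : {rmorphism R -> S}) a x y :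
  f (quad_u a x y) = quad_u (f a) (f x) (f y).
Proof. by rewrite /quad_u !(rmorphD, rmorphM, rmorphXn). Qed.

Lemma rmorph_quad_q (R S : comRingType) (f : {rmorphism R -> S}) a b x y z :
  f (quad_q a b x y z) = quad_q (f a) (f b) (f x) (f y) (f z).
Proof. by rewrite /quad_q !(rmorphD, rmorphM, rmorphXn). Qed.

Lemma rmorph_quad_r (R S : comRingType) (f : {rmorphism R -> S}) b x y z :
  f (quad_r b x y z) = quad_r (f b) (f x) (f y) (f z).
Proof. by rewrite /quad_r !(rmorphB, rmorphD, rmorphM). Qed.

Definition upoly (C : fieldType) (a : C) : {mpoly C[3]} := quad_u a%:MP 'X_0 'X_1.
Definition qpoly (C : fieldType) (a b : C) : {mpoly C[3]} :=
  quad_q a%:MP b%:MP 'X_0 'X_1 'X_2.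
Definition rpoly (C : fieldType) (b : C) : {mpoly C[3]} := quad_r b%:MP 'X_0 'X_1 'X_2.
Definition line (C : fieldType) (c : C) : {mpoly C[3]} := 'X_1 - c%:MP * 'X_0.

(** [Phi] preserves each line through (0 : 0 : 1) and acts on it by the homography that sends [z] to
    [x y z / (u + (b x + y) z)]. Inverting this homography gives [Psi]. *)
Definition Psi (C : fieldType) (a b : C) : triple C :=
  [tuple 'X_0 * rpoly b; 'X_1 * rpoly b; 'X_2 * upoly a].

Lemma PhiE (C : fieldType) (a b : C) :
  Phi a b = [tuple 'X_0 * qpoly a b; 'X_1 * qpoly a b; 'X_0 * 'X_1 * 'X_2].
Proof. by rewrite /Phi -!mul_mpolyC. Qed.

Lemma upoly_comp (C : fieldType) (a : C) (t : triple C) :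
  upoly a \mPo t = quad_u a%:MP (tnth t 0) (tnth t 1).
Proof. by rewrite (rmorph_quad_u (comp_mpoly t)) /= comp_mpolyC !comp_mpolyU. Qed.

Lemma qpoly_comp (C : fieldType) (a b : C) (t : triple C) :
  qpoly a b \mPo t = quad_q a%:MP b%:MP (tnth t 0) (tnth t 1) (tnth t 2).
Proof. by rewrite (rmorph_quad_q (comp_mpoly t)) /= !comp_mpolyC !comp_mpolyU. Qed.

Lemma rpoly_comp (C : fieldType) (b : C) (t : triple C) :
  rpoly b \mPo t = quad_r b%:MP (tnth t 0) (tnth t 1) (tnth t 2).
Proof. by rewrite (rmorph_quad_r (comp_mpoly t)) /= comp_mpolyC !comp_mpolyU. Qed.

Lemma line_comp (C : fieldType) (c : C) (t : triple C) :
  line c \mPo t = tnth t 1 - c%:MP * tnth t 0.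
Proof. by rewrite /line rmorphB rmorphM /= comp_mpolyC !comp_mpolyU. Qed.

Lemma quad_u_factor (C : fieldType) (a c d : C) : c + d = - a -> c * d = 1 ->
  upoly a = line c * line d.
Proof.
move=> cd1 cd2; rewrite /upoly /quad_u /line (_ : a = - (c + d)); last by rewrite cd1 opprK.
rewrite mpolyCN mpolyCD; have : (c * d)%:MP = 1 :> {mpoly C[3]} by rewrite cd2 mpolyC1.
rewrite mpolyCM; move: (c%:MP) (d%:MP) ('X_0) ('X_1) => c1 d1 x y e.
by rewrite -[x ^+ 2]mul1r -e; ring.
Qed.

Lemma PhiPsi (C : fieldType) (a b : C) i :
  tnth (comp_triple (Phi a b) (Psi a b)) i =
  ('X_0 * 'X_1 * upoly a * rpoly b ^+ 2) * 'X_i.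
Proof.
move: i; apply: ord3_ind; rewrite tnth_comp_triple PhiE (tnth_nth 0) /=
  !rmorphM /= ?qpoly_comp !comp_mpolyU !(tnth_nth 0) /= /upoly /rpoly;
  move: ('X_0) ('X_1) ('X_2) (a%:MP) (b%:MP) => x y z {}a {}b;
  rewrite /quad_q /quad_u /quad_r; ring.
Qed.

Lemma PsiPhi (C : fieldType) (a b : C) i :
  tnth (comp_triple (Psi a b) (Phi a b)) i =
  ('X_0 * 'X_1 * upoly a * qpoly a b ^+ 2) * 'X_i.
Proof.
move: i; apply: ord3_ind; rewrite tnth_comp_triple (tnth_nth 0) /=
  !rmorphM /= ?rpoly_comp ?upoly_comp !comp_mpolyU PhiE !(tnth_nth 0) /= /upoly /qpoly;
  move: ('X_0) ('X_1) ('X_2) (a%:MP) (b%:MP) => x y z {}a {}b;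
  rewrite /quad_q /quad_u /quad_r; ring.
Qed.

Definition form3 (C : fieldType) (v0 v1 v2 : C) : 'I_3 -> C :=
  fun i => if i == 0 then v0 else if i == 1 then v1 else v2.

Lemma linear_form3 (C : fieldType) (v0 v1 v2 : C) :
  linear_form (form3 v0 v1 v2) = v0%:MP * 'X_0 + v1%:MP * 'X_1 + v2%:MP * 'X_2.
Proof. by rewrite /linear_form sum3 /form3 /= -!mul_mpolyC. Qed.

Lemma prime_line (C : fieldType) (c : C) : prime_elt (line c).
Proof.
rewrite (_ : line c = linear_form (form3 (- c) 1 0)).
  by apply: (@prime_linear_form _ _ 1); rewrite /form3 /= oner_neq0.
by rewrite linear_form3 mpolyCN mpolyC0 mpolyC1 /line; ring.
Qed.

Lemma homog_X (C : fieldType) (i : 'I_3) : ('X_i : {mpoly C[3]}) \is 1.-homog.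
Proof. by rewrite dhomogX /= mdeg1. Qed.

Lemma homog_XX (C : fieldType) (i j : 'I_3) : ('X_i * 'X_j : {mpoly C[3]}) \is 2.-homog.
Proof. exact: (dhomogM (homog_X C i) (homog_X C j)). Qed.

Lemma homog_CM (C : fieldType) (p : {mpoly C[3]}) c d :
  p \is d.-homog -> c%:MP * p \is d.-homog.
Proof. by rewrite mul_mpolyC; apply: dhomogZ. Qed.

Lemma homog_upoly (C : fieldType) (a : C) : upoly a \is 2.-homog.
Proof.
rewrite /upoly /quad_u !expr2.
by do 2?[apply: dhomogD]; rewrite ?homog_CM ?homog_XX.
Qed.

Lemma homog_qpoly (C : fieldType) (a b : C) : qpoly a b \is 2.-homog.
Proof.
rewrite /qpoly /quad_q !expr2.
by do 4?[apply: dhomogD]; rewrite ?homog_CM ?homog_XX.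
Qed.

Lemma prime_vform (C : fieldType) (b : C) : prime_elt (b%:MP * 'X_0 + 'X_1 : {mpoly C[3]}).
Proof.
rewrite (_ : _ + _ = linear_form (form3 b 1 0)).
  by apply: (@prime_linear_form _ _ 1); rewrite /form3 /= oner_neq0.
by rewrite linear_form3 mpolyC0 mpolyC1; ring.
Qed.

Lemma homog_vform (C : fieldType) (b : C) : (b%:MP * 'X_0 + 'X_1 : {mpoly C[3]}) \is 1.-homog.
Proof. by apply: dhomogD; rewrite ?homog_CM ?homog_X. Qed.

(** The conic is the graph [z = - u / (b x + y)]. The denominator does not divide [u], whose value
    at its zero (1, - b) is [1 - a * b + b ^+ 2]. *)
Lemma prime_qpoly (C : fieldType) (a b : C) :
  1 - a * b + b ^+ 2 != 0 -> prime_elt (qpoly a b).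
Proof.
move=> ab; rewrite (_ : qpoly a b = (b%:MP * 'X_0 + 'X_1) * 'X_2 + upoly a); last first.
  by rewrite /qpoly /upoly /quad_q /quad_u; ring.
apply: prime_graph; first exact: prime_vform.
- move=> /(@meval_dvd0 _ _ _ (form3 1 (- b) 0)).
  rewrite (rmorph_quad_u (meval _)) /= mevalD mevalM !mevalC !mevalXU /quad_u /form3 /=.
  move=> H; move/eqP: ab; apply; rewrite -[RHS]H; first by ring.
  by rewrite mulr1 subrr.
- exact: homog_vform.
- exact: homog_upoly.
- by rewrite rmorphD rmorphM /= comp_mpolyC !comp_mpolyU !(tnth_nth 0) /=; ring.
- by rewrite upoly_comp !(tnth_nth 0) /= /upoly /quad_u; ring.
Qed.

Lemma prime_rpoly (C : fieldType) (b : C) : b != 0 -> prime_elt (- rpoly b).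
Proof.
move=> b0; rewrite (_ : - rpoly b = (b%:MP * 'X_0 + 'X_1) * 'X_2 + - ('X_0 * 'X_1)); last first.
  by rewrite /rpoly /quad_r; ring.
apply: prime_graph; first exact: prime_vform.
- move=> /(@meval_dvd0 _ _ _ (form3 1 (- b) 0)).
  rewrite mevalN !(mevalD, mevalM, mevalC, mevalXU) /form3 /= => H.
  by move/eqP: b0; apply; rewrite -[RHS]H ?mulr1 ?subrr // mul1r opprK.
- exact: homog_vform.
- by rewrite dhomogN homog_XX.
- by rewrite rmorphD rmorphM /= comp_mpolyC !comp_mpolyU !(tnth_nth 0) /=; ring.
- by rewrite rmorphN rmorphM /= !comp_mpolyU !(tnth_nth 0) /=; ring.
Qed.

(** The coefficients contribute [h ^+ 3] and the differentials one more [h]; the terms in the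
    derivatives of [h] cancel by the Euler relation. *)
Lemma pullback_scale (C : fieldType) (w t : triple C) (h : {mpoly C[3]}) j :
  form2 w -> (forall i, tnth t i = h * 'X_i) ->
  tnth (pullback_form t w) j = h ^+ 4 * tnth w j.
Proof.
move=> [hw _ ew] tE.
have wE i : tnth w i \mPo t = h ^+ 3 * tnth w i.
  rewrite -{2}[tnth w i]comp_mpoly_id; apply: comp_homog_scale => // k.
  by rewrite tE tnth_mktuple.
rewrite tnth_pullback.
under eq_bigr => i _ do rewrite wE tE mderivM mderivU.
transitivity (h ^+ 3 * h^`M(j) * (\sum_(i < 3) 'X_i * tnth w i)
    + \sum_(i < 3) h ^+ 4 * ((i == j)%:R * tnth w i)).
  rewrite mulr_sumr -big_split; apply: eq_bigr => i _ /=.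
  move: (tnth w i) ('X_i) ((i == j)%:R) (h^`M(j)) => x y z k; ring.
rewrite ew mulr0 add0r (bigD1 j) //= eqxx mul1r big1 ?addr0 // => i /negPf ->.
by rewrite mul0r mulr0.
Qed.

Definition contracted (C : fieldType) (a b c d : C) : seq {mpoly C[3]} :=
  [:: 'X_0; 'X_1; line c; line d; qpoly a b].

Lemma prime_contracted (C : fieldType) (a b c d : C) :
  1 - a * b + b ^+ 2 != 0 -> forall p, p \in contracted a b c d -> prime_elt p.
Proof.
move=> ab p; rewrite !inE => /or4P[/eqP->|/eqP->|/eqP->|/orP[/eqP->|/eqP->]].
- exact: prime_X.
- exact: prime_X.
- exact: prime_line.
- exact: prime_line.
- exact: prime_qpoly.
Qed.

(** Pulling back by [Psi] shows that [g o Psi] times a form equals the fourth power of [x y u r^2]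
    times [w]; as [w] is coprime, [g o Psi] has only prime factors from [T]. Composition with [Phi]
    turns these into products of contracted curves, and [g o Psi] into [g] times the eighth power of
    [x y u q^2], since [g] has degree 8. *)
Lemma common_factor_supported (C : fieldType) (a b c d : C) (w e : triple C)
    (g : {mpoly C[3]}) :
  c + d = - a -> c * d = 1 -> 1 - a * b + b ^+ 2 != 0 -> form2 w ->
  g \is 8.-homog ->
  (forall j, tnth (pullback_form (Phi a b) w) j = g * tnth e j) ->
  supported (contracted a b c d) g.
Proof.
move=> cd1 cd2 ab fw hg We; have [_ cw _] := fw.
set P := contracted a b c d.
have uE := quad_u_factor cd1 cd2.
have P0 : supported P 'X_0 by apply: supported_mem; rewrite !inE eqxx.
have P1 : supported P 'X_1 by apply: supported_mem; rewrite !inE eqxx orbT.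
have Pc : supported P (line c) by apply: supported_mem; rewrite !inE eqxx !orbT.
have Pd : supported P (line d) by apply: supported_mem; rewrite !inE eqxx !orbT.
have Pq : supported P (qpoly a b) by apply: supported_mem; rewrite !inE eqxx !orbT.
have Pu : supported P (upoly a) by rewrite uE; apply: supported_mul.
(* For [b = 0] the conic [rpoly b] splits as ['X_1 * ('X_0 - 'X_2)]; its new factor then takes its
   place among the primes. *)
pose r2 := if b == 0 then 'X_0 - 'X_2 else - rpoly b : {mpoly C[3]}.
pose T := [:: 'X_0; 'X_1; line c; line d; r2].
have T0 : supported T 'X_0 by apply: supported_mem; rewrite !inE eqxx.
have T1 : supported T 'X_1 by apply: supported_mem; rewrite !inE eqxx orbT.
have Tc : supported T (line c) by apply: supported_mem; rewrite !inE eqxx !orbT.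
have Td : supported T (line d) by apply: supported_mem; rewrite !inE eqxx !orbT.
have Tr : supported T (rpoly b).
  have Tr2 : supported T r2 by apply: supported_mem; rewrite !inE eqxx !orbT.
  have [b0|b0] := eqVneq b 0.
    rewrite (_ : rpoly b = 'X_1 * r2); first exact: supported_mul.
    by rewrite /r2 b0 eqxx /rpoly /quad_r mpolyC0; ring.
  rewrite (_ : rpoly b = - 1 * r2); last by rewrite /r2 (negPf b0) mulN1r opprK.
  by apply: supported_mul => //; apply: supported_unit; rewrite unitrN unitr1.
have primeT p : p \in T -> prime_elt p.
  rewrite !inE => /or4P[/eqP->|/eqP->|/eqP->|/orP[/eqP->|/eqP->]].
  - exact: prime_X.
  - exact: prime_X.
  - exact: prime_line.
  - exact: prime_line.
  - rewrite /r2; case: eqVneq => [_|]; last exact: prime_rpoly.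
    rewrite (_ : 'X_0 - 'X_2 = linear_form (form3 1 0 (-1))).
      by apply: (@prime_linear_form _ _ 0); rewrite /form3 /= oner_neq0.
    by rewrite linear_form3 mpolyCN mpolyC0 mpolyC1; ring.
have gPsi : supported T (g \mPo Psi a b).
  apply: (@strip_primes _ T _ (('X_0 * 'X_1 * upoly a * rpoly b ^+ 2) ^+ 4)
    (fun j => tnth (pullback_form (Psi a b) e) j) (tnth w)) => //.
  - apply/supported_exp/supported_mul; last exact: supported_exp.
    by rewrite uE; do 2?[apply: supported_mul] => //; apply: supported_mul.
  - move=> j; rewrite mulrC -(pullbackZ _ We) -pullback_comp.
    by apply: pullback_scale => // i; apply: PhiPsi.
have gK : supported P (('X_0 * 'X_1 * upoly a * qpoly a b ^+ 2) ^+ 8 * g).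
  rewrite -[g]comp_mpoly_id.
  rewrite -(@comp_homog_scale _ _ _ _ (comp_triple (Psi a b) (Phi a b)) _ hg); last first.
    by move=> i; rewrite PsiPhi tnth_mktuple.
  rewrite -comp_mpolyA; apply: (supported_comp _ gPsi) => p.
  have lineP k : line k \mPo Phi a b = line k * qpoly a b.
    by rewrite line_comp PhiE !(tnth_nth 0) /= /line; ring.
  rewrite !inE => /or4P[/eqP->|/eqP->|/eqP->|/orP[/eqP->|/eqP->]].
  - by rewrite comp_mpolyU PhiE (tnth_nth 0) /=; apply: supported_mul.
  - by rewrite comp_mpolyU PhiE (tnth_nth 0) /=; apply: supported_mul.
  - by rewrite lineP; apply: supported_mul.
  - by rewrite lineP; apply: supported_mul.
  - rewrite /r2; case: eqVneq => [b0|_].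
      rewrite rmorphB /= !comp_mpolyU PhiE !(tnth_nth 0) /=.
      rewrite (_ : _ - _ = 'X_0 * upoly a); first exact: supported_mul.
      by rewrite b0 /qpoly /quad_q /upoly /quad_u mpolyC0; ring.
    rewrite rmorphN /= rpoly_comp PhiE !(tnth_nth 0) /=.
    rewrite (_ : - _ = - 1 * ('X_0 * 'X_1 * upoly a * qpoly a b)).
      apply: supported_mul; first by apply: supported_unit; rewrite unitrN unitr1.
      by do 3![apply: supported_mul => //].
    by rewrite /qpoly /quad_q /upoly /quad_u /quad_r; ring.
apply: (@strip_primes _ P _ _ (fun=> ('X_0 * 'X_1 * upoly a * qpoly a b ^+ 2) ^+ 8)
  (fun=> 1) _ gK).
- exact: prime_contracted.
- by move=> _; rewrite mulr1.
- move=> h /(_ 0) [k kE]; apply/unitrP; exists k.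
  by rewrite [h * k]mulrC -kE.
Qed.

Lemma supported5 (C : fieldType) (f0 f1 f2 f3 f4 g : {mpoly C[3]}) :
  supported [:: f0; f1; f2; f3; f4] g -> exists c n0 n1 n2 n3 n4,
  c \is a GRing.unit /\
  g = c * (f0 ^+ n0 * f1 ^+ n1 * f2 ^+ n2 * f3 ^+ n3 * f4 ^+ n4).
Proof.
case=> c [Q [cu QP ->]]; exists c.
suff [n0 [n1 [n2 [n3 [n4 ->]]]]] : exists n0 n1 n2 n3 n4, \prod_(p <- Q) p =
    f0 ^+ n0 * f1 ^+ n1 * f2 ^+ n2 * f3 ^+ n3 * f4 ^+ n4.
  by exists n0, n1, n2, n3, n4.
elim: Q QP => [|p Q IH] QP.
  by exists 0%N, 0%N, 0%N, 0%N, 0%N; rewrite big_nil !mulr1.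
have [|n0 [n1 [n2 [n3 [n4 E]]]]] := IH; first by move=> q qQ; apply: QP; rewrite inE qQ orbT.
rewrite big_cons E.
have := QP p; rewrite inE eqxx /= => /(_ isT).
rewrite !inE => /or4P[/eqP->|/eqP->|/eqP->|/orP[/eqP->|/eqP->]].
- by exists n0.+1, n1, n2, n3, n4; rewrite exprS; ring.
- by exists n0, n1.+1, n2, n3, n4; rewrite (exprS f1); ring.
- by exists n0, n1, n2.+1, n3, n4; rewrite (exprS f2); ring.
- by exists n0, n1, n2, n3.+1, n4; rewrite (exprS f3); ring.
- by exists n0, n1, n2, n3, n4.+1; rewrite (exprS f4); ring.
Qed.

Lemma common_factor_exponents (C : fieldType) (a b c d : C) (w e : triple C)
    (g : {mpoly C[3]}) :
  c + d = - a -> c * d = 1 -> 1 - a * b + b ^+ 2 != 0 -> form2 w ->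
  (forall j, tnth e j \is 3.-homog) ->
  (forall j, tnth (pullback_form (Phi a b) w) j = g * tnth e j) ->
  exists k n0 n1 n2 n3 n4,
  [/\ k \is a GRing.unit,
      g = k * ('X_0 ^+ n0 * 'X_1 ^+ n1 * line c ^+ n2 * line d ^+ n3 * qpoly a b ^+ n4) &
      (n0 + n1 + n2 + n3 + 2 * n4 = 8)%N].
Proof.
move=> cd1 cd2 ab fw he We; have [hw _ ew] := fw.
have w2 := contact_neq0 fw.
have hq := homog_qpoly a b.
have hPhi i : tnth (Phi a b) i \is 3.-homog.
  move: i; apply: ord3_ind; rewrite PhiE (tnth_nth 0) /=.
  - exact: (dhomogM (homog_X C 0) hq).
  - exact: (dhomogM (homog_X C 1) hq).
  - exact: (dhomogM (homog_XX C 0 1) (homog_X C 2)).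
have hW j : tnth (pullback_form (Phi a b) w) j \is (8 + 3).-homog.
  rewrite tnth_pullback; apply: rpred_sum => i _.
  exact: (dhomogM (comp_homog (hw i) hPhi) (mderiv_homog j (hPhi i))).
have r0 : rpoly b != 0.
  apply/eqP => /(congr1 (meval (form3 1 1 0))).
  rewrite (rmorph_quad_r (meval _)) /= mevalC !mevalXU meval0 /quad_r /form3 /=.
  by rewrite !mulr1 mulr0 subr0; apply/eqP/oner_neq0.
have Hn0 : 'X_0 * 'X_1 * upoly a * rpoly b ^+ 2 != 0 :> {mpoly C[3]}.
  have X0 i := (prime_X C i).1; have L0 k := (prime_line k).1.
  rewrite (quad_u_factor cd1 cd2); apply: mulf_neq0; last exact: expf_neq0.
  by apply: mulf_neq0; apply: mulf_neq0; rewrite ?X0 ?L0.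
(* Otherwise the pull-back by [Phi] would be 0, and pulling back further by [Psi] would give a
   nonzero multiple of [w] equal to 0. *)
have [j ej] : exists j, tnth e j != 0.
  apply/existsP; apply: contraNT w2; rewrite negb_exists => /forallP e0.
  have W0 j : tnth (pullback_form (Phi a b) w) j = 0 * tnth w j.
    by rewrite We mul0r; move/negbNE: (e0 j) => /eqP ->; rewrite mulr0.
  have := pullback_scale 2 fw (PhiPsi a b); rewrite pullback_comp (pullbackZ _ W0) comp_mpoly0 mul0r.
  by move/esym/eqP; rewrite mulf_eq0 expf_eq0 (negPf Hn0) andbF.
have hg : g \is 8.-homog by apply: homog_factor (he j) (hW j) (We j).
have g0 : g != 0.
  apply: contraNneq w2 => g0.
  have := pullback_scale 2 fw (PhiPsi a b).
  rewrite pullback_comp (pullbackZ _ We) g0 comp_mpoly0 mul0r.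
  by move/esym/eqP; rewrite mulf_eq0 expf_eq0 (negPf Hn0) andbF.
have := common_factor_supported cd1 cd2 ab fw hg We.
move=> /supported5 [k [n0 [n1 [n2 [n3 [n4 [ku gE]]]]]]].
exists k, n0, n1, n2, n3, n4; split=> //.
apply: (@dhomog_uniq _ _ mdeg g) => //; rewrite gE.
have [k' k'0 ->] := unit_mpoly ku; rewrite mul_mpolyC dhomogZ //.
have hline (x : C) : line x \is 1.-homog.
  by apply: rpredB; rewrite ?homog_CM ?homog_X.
have X n (i : 'I_3) : ('X_i ^+ n : {mpoly C[3]}) \is n.-homog.
  by have := dhomogMn n (homog_X C i); rewrite mul1n.
have L n (x : C) : (line x ^+ n : {mpoly C[3]}) \is n.-homog.
  by have := dhomogMn n (hline x); rewrite mul1n.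
exact: (dhomogM (dhomogM (dhomogM (dhomogM (X _ _) (X _ _)) (L _ _)) (L _ _)) (dhomogMn _ hq)).
Qed.

(** * The five contracted curves *)

Definition mx3 (C : fieldType) (c0 c1 c2 : 'I_3 -> C) : 'M[C]_3 :=
  \matrix_(i, j) (if j == 0 then c0 i else if j == 1 then c1 i else c2 i).

Lemma mx3_unit (C : fieldType) (c0 c1 c2 : 'I_3 -> C) :
  c0 0 * (c1 1 * c2 2 - c1 2 * c2 1) - c1 0 * (c0 1 * c2 2 - c0 2 * c2 1)
    + c2 0 * (c0 1 * c1 2 - c0 2 * c1 1) != 0 ->
  mx3 c0 c1 c2 \in unitmx.
Proof.
set d := _ + _ => d0.
(* The adjugate matrix; [d] is the determinant expanded along the first row. *)
pose adj : 'M[C]_3 := \matrix_(i, j) form3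
  (form3 (c1 1 * c2 2 - c1 2 * c2 1) (c1 2 * c2 0 - c1 0 * c2 2) (c1 0 * c2 1 - c1 1 * c2 0) j)
  (form3 (c0 2 * c2 1 - c0 1 * c2 2) (c0 0 * c2 2 - c0 2 * c2 0) (c0 1 * c2 0 - c0 0 * c2 1) j)
  (form3 (c0 1 * c1 2 - c0 2 * c1 1) (c0 2 * c1 0 - c0 0 * c1 2) (c0 0 * c1 1 - c0 1 * c1 0) j) i.
suff : mx3 c0 c1 c2 *m (d^-1 *: adj) = 1%:M by case/mulmx1_unit.
rewrite -scalemxAr; suff -> : mx3 c0 c1 c2 *m adj = d%:M.
  by rewrite scale_scalar_mx mulVf.
by apply/matrixP; apply: ord3_ind; apply: ord3_ind;
  rewrite !mxE sum3 !mxE /form3 /= /d; ring.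
Qed.

Lemma linear_mx3_comp (C : fieldType) (c0 c1 c2 : 'I_3 -> C) (p q r : {mpoly C[3]}) i :
  tnth (comp_triple (linear_triple (mx3 c0 c1 c2)) [tuple p; q; r]) i =
  (c0 i)%:MP * p + (c1 i)%:MP * q + (c2 i)%:MP * r.
Proof.
rewrite tnth_comp_triple tnth_linear -/(linear_form (fun j => mx3 c0 c1 c2 i j)).
by rewrite linear_form_comp sum3 !mxE /= !(tnth_nth 0) /= -!mul_mpolyC.
Qed.

Lemma qpoly_eval (C : fieldType) (a b : C) (s : 'I_3 -> C) :
  (qpoly a b).@[s] = quad_q a b (s 0) (s 1) (s 2).
Proof. by rewrite (rmorph_quad_q (meval s)) /= !mevalC !mevalXU. Qed.

Lemma line_eval (C : fieldType) (c : C) (s : 'I_3 -> C) :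
  (line c).@[s] = s 1 - c * s 0.
Proof. by rewrite /line mevalB mevalM mevalC !mevalXU. Qed.

Lemma mderiv_qpoly2 (C : fieldType) (a b : C) :
  (qpoly a b)^`M(2) = b%:MP * 'X_0 + 'X_1.
Proof.
rewrite /qpoly /quad_q !expr2 !(mderivD, mderivM, mderivC, mderivU) /=; ring.
Qed.

Lemma mderiv_line (C : fieldType) (c : C) i :
  (line c)^`M(i) = (1 == i)%:R - c%:MP * (0 == i)%:R.
Proof. by rewrite /line mderivB mderivM mderivC !mderivU mul0r add0r. Qed.

(** On [x = 0] the conic equation restricts to [y^2 + y z]. Subtracting [y z] leaves [y^2], so the
    slope is [z / y] and can be prescribed freely. The slope -1 is excluded because [qpoly] vanishes
    there. *)
Lemma contraction_x (C : numFieldType) (a b : C) :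
  contraction 'X_0 (qpoly a b - 'X_1 * 'X_2) ('X_1 * 'X_2) ('X_1 * qpoly a b).
Proof.
exists [:: -1] => x; rewrite inE => xb; exists (form3 0 1 x), (@axis C 2); split.
- rewrite !(mevalB, mevalM, mevalXU) qpoly_eval /quad_q /form3 /=; split.
  + by [].
  + by rewrite (_ : _ - _ = 1) ?oner_neq0 //; ring.
  + by rewrite -[LHS]mulr1; congr (_ * _); ring.
  + by rewrite (_ : _ * _ = x - -1) ?subr_eq0 //; ring.
- by exists 0; rewrite mderivU meval1 oner_neq0.
- by rewrite sum3 !mderivU /axis /= !meval0 !mul0r mulr0 !addr0.
- rewrite sum3 /axis /= !mul0r !add0r mul1r mderivB mderiv_qpoly2 mderivM !mderivU /=.
  move: (qpoly a b) (qpoly_eval a b (form3 0 1 x)) => Q QE.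
  rewrite !(mevalB, mevalM, mevalD, mevalC, mevalXU, meval0, meval1) QE /quad_q /form3 /=.
  by rewrite (_ : _ - _ = 1) ?oner_neq0 //; ring.
Qed.

Lemma contraction_y (C : numFieldType) (a b : C) :
  contraction 'X_1 (qpoly a b - b%:MP * 'X_0 * 'X_2) ('X_0 * 'X_2) ('X_0 * qpoly a b).
Proof.
(* The zero of [1 + b * x]. For [b = 0] the default inverse excludes the slope 0, harmlessly. *)
exists [:: - b^-1] => x; rewrite inE => xb; exists (form3 1 0 x), (@axis C 2); split.
- rewrite !(mevalB, mevalM, mevalXU, mevalC) qpoly_eval /quad_q /form3 /=; split.
  + by [].
  + by rewrite (_ : _ - _ = 1) ?oner_neq0 //; ring.
  + by rewrite -[LHS]mulr1; congr (_ * _); ring.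
  + rewrite (_ : _ * _ = 1 + b * x); last by ring.
    apply: contra xb => /eqP bx.
    have b0 : b != 0 by apply: contraTneq (oner_neq0 C) => b0; rewrite -bx b0 mul0r addr0 eqxx.
    by apply/eqP/(mulfI b0); rewrite mulrN divff //; apply/eqP; rewrite -addr_eq0 addrC bx.
- by exists 1; rewrite mderivU meval1 oner_neq0.
- by rewrite sum3 !mderivU /axis /= !meval0 !mul0r mulr0 !addr0.
- rewrite sum3 /axis /= !mul0r !add0r mul1r mderivB mderiv_qpoly2 !mderivM mderivC !mderivU /=.
  move: (qpoly a b) (qpoly_eval a b (form3 1 0 x)) => Q QE.
  rewrite !(mevalB, mevalM, mevalD, mevalC, mevalXU, meval0, meval1) QE /quad_q /form3 /=.
  by rewrite (_ : _ - _ = 1) ?oner_neq0 //; ring.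
Qed.

(** On the line, [qpoly] equals [(b + c) x z]. Subtracting [b] times it removes [z] from the second
    polynomial and leaves [k x^2]. The slope is thus a nonzero multiple of [z / x], and [s] is the
    point where it is the given [x]. *)
Lemma contraction_line (C : numFieldType) (a b c d : C) :
  c + d = - a -> c * d = 1 -> c != d -> b + c != 0 ->
  contraction (line c) (((b + c)%:MP * 'X_0) * (b%:MP * 'X_2 - c%:MP * line d) - b%:MP * qpoly a b)
    (qpoly a b) ('X_0 * qpoly a b).
Proof.
move=> cd1 cd2 cd bc.
have c0 : c != 0 by apply: contraTneq (oner_neq0 C) => c0; rewrite -cd2 c0 mul0r eqxx.
have aE : a = - (c + d) by rewrite cd1 opprK.
have u0 : 1 + c ^+ 2 + a * c = 0 by rewrite -cd2 aE; ring.
pose k := - (b + c) * c * (c - d).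
have k0 : k != 0 by rewrite /k !mulf_neq0 ?oppr_eq0 ?subr_eq0.
exists [:: 0] => x; rewrite inE => x0; pose s := form3 1 c (- x * c * (c - d)).
have sq : (qpoly a b).@[s] = x * k.
  rewrite qpoly_eval /quad_q /s /form3 /=.
  rewrite (_ : _ + _ = 1 + c ^+ 2 + a * c + x * k); first by rewrite u0 add0r.
  by rewrite /k; ring.
have sp : ((b + c)%:MP * 'X_0 * (b%:MP * 'X_2 - c%:MP * line d) - b%:MP * qpoly a b).@[s] = k.
  rewrite !(mevalB, mevalM, mevalC, mevalXU) sq /s /form3 /= /k; ring.
exists s, (@axis C 2); split.
- rewrite sp mevalM mevalXU sq; split=> //.
  + by rewrite line_eval /s /form3 /= mulr1 subrr.
  + by rewrite /s /form3 /= mul1r mulf_neq0.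
- by exists 1; rewrite mderiv_line /= mulr0 subr0 meval1 oner_neq0.
- by rewrite sum3 !mderiv_line /axis /= !mul0r mulr0 subrr meval0 mulr0 !addr0.
- rewrite sum3 /axis /= !mul0r !add0r mul1r mderiv_qpoly2 mevalB mevalM sp.
  (* The derivative in [z] of the second polynomial is [- b] times the equation of the line. *)
  rewrite [X in _ - X]mevalM [X in _ - _ * X](_ : _ = 0).
    rewrite mulr0 subr0 mevalD mevalM mevalC !mevalXU /s /form3 /= mulr1.
    by rewrite mulf_neq0.
  rewrite mderivB !mderivM mderivB !mderivM mderiv_line mderiv_qpoly2 !mderivC !mderivU /=.
  rewrite !(mevalB, mevalM, mevalD, mevalC, mevalXU, meval0, meval1) /s /form3 /=; ring.
Qed.

(** The conic is parametrised by the slope of the line through (0 : 0 : 1), with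
    [z = - u / (b x + y)] cleared of its denominator; [u] is [(x - c) (x - d)] at (1, x). The
    excluded slopes are the zeros of [h] in this parametrisation. *)
Lemma contraction_conic (C : numFieldType) (a b c d : C) :
  c + d = - a -> c * d = 1 ->
  contraction (qpoly a b) 'X_0 'X_1 ('X_0 * 'X_1 * 'X_2).
Proof.
move=> cd1 cd2; have aE : a = - (c + d) by rewrite cd1 opprK.
exists [:: - b; 0; c; d] => x; rewrite !inE !negb_or => /and4P[xb x0 xc xd].
have bx : b + x != 0 by rewrite addrC -[b]opprK subr_eq0.
pose s := form3 (b + x) (x * (b + x)) (- ((x - c) * (x - d))).
have s2 : (qpoly a b)^`M(2).@[s] != 0.
  rewrite mderiv_qpoly2 mevalD mevalM mevalC !mevalXU /s /form3 /=.
  by rewrite (_ : _ + _ = (b + x) ^+ 2) ?expf_neq0 //; ring.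
exists s, (form3 0 (qpoly a b)^`M(2).@[s] (- (qpoly a b)^`M(1).@[s])); split.
- rewrite !mevalM !mevalXU qpoly_eval; split=> //.
  + rewrite /s /form3 /= /quad_q.
    rewrite (_ : _ + _ = (b + x) ^+ 2 * (1 + a * x + (c + d) * x - c * d)); last by ring.
    by rewrite cd1 cd2; ring.
  + by rewrite /s /form3 /= !mulf_neq0 ?oppr_eq0 ?mulf_neq0 ?subr_eq0.
- by exists 2.
- by rewrite sum3 /form3 /=; ring.
- rewrite sum3 !mevalB !mevalM !mderivU /form3 /= !mevalXU !meval0 !meval1 /=.
  rewrite (_ : _ + _ = (qpoly a b)^`M(2).@[s] * (b + x)); first by rewrite mulf_neq0.
  by rewrite /s /form3 /=; ring.
Qed.

Lemma sing_eq (C : fieldType) (w : triple C) (s s' : 'I_3 -> C) :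
  s =1 s' -> sing w s -> sing w s'.
Proof. by move=> E ws i; rewrite -(meval_eq _ E). Qed.

Lemma sing2_eq (C : fieldType) (w : triple C) (s s' : 'I_3 -> C) :
  s =1 s' -> sing2 w s -> sing2 w s'.
Proof.
move=> E [ws ws2]; split; first exact: sing_eq ws.
by move=> i j; rewrite -!(meval_eq _ E).
Qed.

(** What an exponent [n] of a contracted curve implies at its image point [s]. *)
Definition mult_spec (C : fieldType) (w : triple C) (s : 'I_3 -> C) (n : nat) :=
  [/\ (n <= 2)%N, (0 < n)%N -> sing w s & (1 < n)%N -> sing2 w s].

Lemma dvd_exp (C : fieldType) (f : {mpoly C[3]}) m n :
  (m <= n)%N -> dvd (f ^+ m) (f ^+ n).
Proof. by move=> mn; exists (f ^+ (n - m)); rewrite -exprD subnK. Qed.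

(** The matrix with columns [c0], [c1], [c2] carries (0 : 0 : 1) to the image point [c2], which
    reduces the claim to the local model (f p : f q : h). *)
Lemma contraction_spec (C : numFieldType) (t w : triple C) (c0 c1 c2 : 'I_3 -> C)
    (f p q h g : {mpoly C[3]}) (e : triple C) n :
  form2 w -> contraction f p q h ->
  c0 0 * (c1 1 * c2 2 - c1 2 * c2 1) - c1 0 * (c0 1 * c2 2 - c0 2 * c2 1)
    + c2 0 * (c0 1 * c1 2 - c0 2 * c1 1) != 0 ->
  (forall i, tnth t i = (c0 i)%:MP * (f * p) + (c1 i)%:MP * (f * q) + (c2 i)%:MP * h) ->
  (forall j, tnth (pullback_form t w) j = g * tnth e j) ->
  dvd (f ^+ n) g -> mult_spec w c2 n.
Proof.
move=> fw con /mx3_unit Mu tE We fg; set M := mx3 _ _ _ in Mu.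
have fW m j : (m <= n)%N -> dvd (f ^+ m) (tnth (pullback_form t w) j).
  by move=> mn; rewrite We; apply/dvd_mulr/(dvd_trans (dvd_exp f mn)).
have tM : t = comp_triple (linear_triple M) [tuple f * p; f * q; h].
  by apply: eq_from_tnth => i; rewrite linear_mx3_comp tE.
rewrite tM pullback_comp in fW.
have [s1 s2 s3] := contraction_mult (form2_linear Mu fw) con.
have colE : (fun i => M i 2) =1 c2 by move=> i; rewrite !mxE.
split.
- by rewrite leqNgt; apply/negP => n3; apply: s3 => j; apply: fW.
- move=> n0; apply: (sing_eq colE); apply: (sing_linearV Mu); apply: s1 => j.
  by rewrite -[f]expr1; apply: fW.
- by move=> n1; apply: (sing2_eq colE); apply: (sing2_linearV Mu); apply: s2 => j; apply: fW.
Qed.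

(** The image of the line [y = c x] under [Phi], as [qpoly] is [(b + c) x z] on it. *)
Definition contr_pt (C : fieldType) (b c : C) := form3 1 c (c / (b + c)).

(** Here [i] is the inverse of [b + c]. The third component of [Phi], less its part
    [c * i * (x * q)] along the image point, is a multiple of the equation [l] of the line; it is
    split as [contraction_line] requires. *)
Lemma line_contraction_identity (R : comRingType) (b c i x y z m : R) :
  (b + c) * i = 1 ->
  let l := y - c * x in let q := z * (b * x + y) + l * m in
  x * y * z = i * i * (l * ((b + c) * x * (b * z - c * m) - b * q))
    + b * (i * i) * (l * q) + c * i * (x * q).
Proof.
move=> e l q.
transitivity (((b + c) * i) * (i * l * x * (b * z - c * m)) + c * i * (x * q)); last by ring.
by rewrite e mul1r -[LHS]mul1r -e /q /l; ring.
Qed.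

Lemma line_contraction_spec (C : numFieldType) (a b c d : C) (w e : triple C)
    (g : {mpoly C[3]}) n :
  c + d = - a -> c * d = 1 -> c != d -> b + c != 0 -> form2 w ->
  (forall j, tnth (pullback_form (Phi a b) w) j = g * tnth e j) ->
  dvd (line c ^+ n) g -> mult_spec w (contr_pt b c) n.
Proof.
move=> cd1 cd2 cd bc fw We.
have i0 : (b + c)^-1 != 0 by rewrite invr_eq0.
apply: (@contraction_spec _ _ _ (form3 0 0 ((b + c)^-1 * (b + c)^-1))
  (form3 0 1 (b * ((b + c)^-1 * (b + c)^-1))) _ _ _ _ _ _ _ _ fw
  (contraction_line cd1 cd2 cd bc) _ _ We).
  rewrite /form3 /contr_pt /form3 /=.
  rewrite (_ : _ + _ = - ((b + c)^-1 * (b + c)^-1)) ?oppr_eq0 ?mulf_neq0 //; ring.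
have aE : a = - (c + d) by rewrite cd1 opprK.
have qL : qpoly a b = 'X_2 * (b%:MP * 'X_0 + 'X_1) + line c * line d.
  by rewrite -(quad_u_factor cd1 cd2) /qpoly /upoly /quad_q /quad_u; ring.
move=> i; rewrite PhiE; move: i; apply: ord3_ind; rewrite (tnth_nth 0) /= /contr_pt /form3 /=.
- by rewrite mpolyC0 mpolyC1; ring.
- by rewrite mpolyC0 mpolyC1 /line; ring.
have key : (b + c)%:MP * ((b + c)^-1)%:MP = 1 :> {mpoly C[3]}.
  by rewrite -mpolyCM divff // mpolyC1.
rewrite !mpolyCM mpolyCD in key *; rewrite qL /line.
exact: line_contraction_identity key.
Qed.

Lemma mult_spec_all (C : numFieldType) (a b c d : C) (w e : triple C) (g : {mpoly C[3]}) :
  c + d = - a -> c * d = 1 -> c != d -> b + c != 0 -> b + d != 0 -> form2 w ->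
  (forall j, tnth e j \is 3.-homog) ->
  (forall j, tnth (pullback_form (Phi a b) w) j = g * tnth e j) ->
  exists n0 n1 n2 n3 n4,
  [/\ mult_spec w (form3 0 1 0) n0, mult_spec w (form3 1 0 0) n1,
      mult_spec w (contr_pt b c) n2 /\ mult_spec w (contr_pt b d) n3,
      mult_spec w (form3 0 0 1) n4 & (n0 + n1 + n2 + n3 + 2 * n4 = 8)%N].
Proof.
move=> cd1 cd2 cd bc bd fw he We.
have ab : 1 - a * b + b ^+ 2 != 0.
  rewrite (_ : _ + _ = (b + c) * (b + d)) ?mulf_neq0 // -cd2.
  by rewrite (_ : a = - (c + d)); [ring|rewrite cd1 opprK].
have [k [n0 [n1 [n2 [n3 [n4 [ku gE n8]]]]]]] := common_factor_exponents cd1 cd2 ab fw he We.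
exists n0, n1, n2, n3, n4.
have dc1 : d + c = - a by rewrite addrC.
have dc2 : d * c = 1 by rewrite mulrC.
split=> //; first 1 last.
- apply: (@contraction_spec _ _ _ (form3 0 1 0) (form3 0 (b) 1) _ _ _ _ _ _ _ _ fw
    (contraction_y a b) _ _ We).
  + rewrite /form3 /=.
    by rewrite (_ : _ + _ = 1) ?oner_neq0 //; ring.
  + move=> i; rewrite PhiE; move: i; apply: ord3_ind; rewrite (tnth_nth 0) /= /form3 /=;
      rewrite ?mpolyC0 ?mpolyC1; ring.
  + by rewrite gE; exists (k * ('X_0 ^+ n0 * line c ^+ n2 * line d ^+ n3 * qpoly a b ^+ n4)); ring.
- split.
  + apply: (line_contraction_spec cd1 cd2 cd bc fw We).
    by rewrite gE; exists (k * ('X_0 ^+ n0 * 'X_1 ^+ n1 * line d ^+ n3 * qpoly a b ^+ n4)); ring.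
  + apply: (line_contraction_spec dc1 dc2 _ bd fw We); first by rewrite eq_sym.
    by rewrite gE; exists (k * ('X_0 ^+ n0 * 'X_1 ^+ n1 * line c ^+ n2 * qpoly a b ^+ n4)); ring.
- apply: (@contraction_spec _ _ _ (form3 1 0 0) (form3 0 1 0) _ _ _ _ _ _ _ _ fw
    (contraction_conic b cd1 cd2) _ _ We).
  + rewrite /form3 /=.
    by rewrite (_ : _ + _ = 1) ?oner_neq0 //; ring.
  + move=> i; rewrite PhiE; move: i; apply: ord3_ind; rewrite (tnth_nth 0) /= /form3 /=;
      rewrite ?mpolyC0 ?mpolyC1; ring.
  + by rewrite gE; exists (k * ('X_0 ^+ n0 * 'X_1 ^+ n1 * line c ^+ n2 * line d ^+ n3)); ring.
- apply: (@contraction_spec _ _ _ (form3 1 0 0) (form3 1 0 1) _ _ _ _ _ _ _ _ fw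
    (contraction_x a b) _ _ We).
  + rewrite /form3 /=.
    by rewrite (_ : _ + _ = - 1) ?oppr_eq0 ?oner_neq0 //; ring.
  + move=> i; rewrite PhiE; move: i; apply: ord3_ind; rewrite (tnth_nth 0) /= /form3 /=;
      rewrite ?mpolyC0 ?mpolyC1; ring.
  + by rewrite gE; exists (k * ('X_1 ^+ n1 * line c ^+ n2 * line d ^+ n3 * qpoly a b ^+ n4)); ring.
Qed.

(** * Normal form *)

Lemma sing_coef (C : fieldType) (w : triple C) k i : form2 w -> sing w (@axis C k) ->
  coef3 (tnth w i) ((k == 0)%R * 3) ((k == 1)%R * 3) ((k == 2)%R * 3) = 0.
Proof.
move=> [hw _ _] /(_ i); rewrite (eval_axis _ (hw i)) => <-; congr mcoeff.
by rewrite [RHS]mon3P !mulmnE !mnm1E.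
Qed.

(** The monomials are ['X_k ^+ 2 * 'X_j] and ['X_k ^+ 2 * 'X_i]. As [k] differs from [i] and [j],
    derivation brings out no factor. *)
Lemma sing2_coef (C : fieldType) (w : triple C) k i j : form2 w -> sing2 w (@axis C k) ->
  k != i -> k != j ->
  coef3 (tnth w i) ((k == 0)%R * 2 + (j == 0)%R) ((k == 1)%R * 2 + (j == 1)%R)
    ((k == 2)%R * 2 + (j == 2)%R)
  + coef3 (tnth w j) ((k == 0)%R * 2 + (i == 0)%R) ((k == 1)%R * 2 + (i == 1)%R)
    ((k == 2)%R * 2 + (i == 2)%R) = 0.
Proof.
move=> [hw _ _] [_ /(_ i j)] H ki kj; rewrite -[RHS]H {H}.
have mE l : (mnm_muln (mnm1 k) 2 + mnm1 l)%MM = mon3 ((k == 0)%R * 2 + (l == 0)%R)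
    ((k == 1)%R * 2 + (l == 1)%R) ((k == 2)%R * 2 + (l == 2)%R).
  by rewrite [LHS]mon3P !mnmDE !mnm1E !muln2 -!addnn.
rewrite (mderiv_eval_axis _ _ (hw i)) (mderiv_eval_axis _ _ (hw j)) !mE.
by rewrite (negPf ki) (negPf kj) !mulr1n.
Qed.

Lemma double_eq0 (C : numFieldType) (x : C) : x + x = 0 -> x = 0.
Proof. by move=> /eqP; rewrite -mulr2n mulrn_eq0 => /eqP. Qed.

(** By the Euler relation, the radial linear part at (0 : 0 : 1) removes from the third coefficient
    every term containing [z]. The remaining binary cubic vanishes in the directions 0, infinity,
    [c] and [d]. *)
Lemma no_four_tangents (C : numFieldType) (w : triple C) (b c d : C) :
  form2 w -> c != 0 -> d != 0 -> c != d -> sing2 w (@axis C 2) ->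
  sing w (form3 1 0 0) -> sing w (form3 0 1 0) -> sing w (contr_pt b c) ->
  sing w (contr_pt b d) -> False.
Proof.
move=> fw c0 d0 cd s2 se1 se2 sc sd; have [hw _ ew] := fw; have [s1 _] := s2.
have a003 := sing_coef 0 fw s1; have b003 := sing_coef 1 fw s1.
have c003 := sing_coef 2 fw s1.
have a102 := double_eq0 (sing2_coef (i := 0) (j := 0) fw s2 isT isT).
have b012 := double_eq0 (sing2_coef (i := 1) (j := 1) fw s2 isT isT).
have ab := sing2_coef (i := 0) (j := 1) fw s2 isT isT.
rewrite /= !(mul0n, mul1n, muln1, addn0, add0n) in a003 b003 c003 a102 b012 ab.
have c102 := euler_coef 1 0 3 ew; rewrite a003 addr0 add0r in c102.
have c012 := euler_coef 0 1 3 ew; rewrite b003 !add0r in c012.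
have c201 := euler_coef 2 0 2 ew; rewrite a102 addr0 add0r in c201.
have c021 := euler_coef 0 2 2 ew; rewrite b012 !add0r in c021.
have c111 := euler_coef 1 1 2 ew; rewrite ab add0r in c111.
have wE s : (tnth w 2).@[s] = coef3 (tnth w 2) 3 0 0 * s 0 ^+ 3
    + coef3 (tnth w 2) 2 1 0 * s 0 ^+ 2 * s 1 + coef3 (tnth w 2) 1 2 0 * s 0 * s 1 ^+ 2
    + coef3 (tnth w 2) 0 3 0 * s 1 ^+ 3.
  rewrite cubic_eval // /cubic c003 c102 c012 c201 c021 c111; ring.
have c300 : coef3 (tnth w 2) 3 0 0 = 0.
  by rewrite -(se1 2) wE /form3 /=; ring.
have c030 : coef3 (tnth w 2) 0 3 0 = 0.
  by rewrite -(se2 2) wE /form3 /=; ring.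
have slope x : x != 0 -> sing w (contr_pt b x) ->
    coef3 (tnth w 2) 2 1 0 + coef3 (tnth w 2) 1 2 0 * x = 0.
  move=> x0 /(_ 2); rewrite wE c300 c030 /contr_pt /form3 /= => e.
  by apply: (mulfI x0); rewrite mulr0 -[RHS]e; ring.
have ec := slope c c0 sc; have ed := slope d d0 sd.
have c120 : coef3 (tnth w 2) 1 2 0 = 0.
  apply/eqP; have /eqP : coef3 (tnth w 2) 1 2 0 * (c - d) = 0.
    by rewrite -[RHS](subrr 0) -{1}ec -ed; ring.
  by rewrite mulf_eq0 subr_eq0 (negPf cd) orbF.
have c210 : coef3 (tnth w 2) 2 1 0 = 0 by rewrite -ec c120; ring.
have /eqP := contact_neq0 fw; apply; rewrite (cubicE (hw 2)) /cubic.
rewrite c003 c102 c012 c201 c111 c021 c300 c210 c120 c030 mpolyC0; ring.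
Qed.

(** The weighted sum is 8 out of a maximum of 12. If [n4 = 2], the lines share 4: either each has
    exponent 1, or one has 2 and another is positive. If [n4 = 1], they share 6 and at least two
    have exponent 2. If [n4 = 0], all four have exponent 2. *)
Lemma three_points (C : numFieldType) (w : triple C) (b c d : C) n0 n1 n2 n3 n4 :
  form2 w -> c != 0 -> d != 0 -> c != d -> b + c != 0 ->
  mult_spec w (form3 0 1 0) n0 -> mult_spec w (form3 1 0 0) n1 ->
  mult_spec w (contr_pt b c) n2 -> mult_spec w (contr_pt b d) n3 ->
  mult_spec w (form3 0 0 1) n4 -> (n0 + n1 + n2 + n3 + 2 * n4 = 8)%N ->
  exists c0 c1 c2 : 'I_3 -> C, [/\ c0 0 * (c1 1 * c2 2 - c1 2 * c2 1)
    - c1 0 * (c0 1 * c2 2 - c0 2 * c2 1) + c2 0 * (c0 1 * c1 2 - c0 2 * c1 1) != 0,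
    sing2 w c0, sing2 w c1 & sing w c2].
Proof.
move=> fw c0 d0 cd bc s0 s1 s2 s3 s4 n8.
(* The determinant that decides whether [p], [q] and (0 : 0 : 1) are collinear; the image points of
   the four lines lie in different directions from (0 : 0 : 1). *)
pose delta (p q : 'I_3 -> C) := p 0 * q 1 - p 1 * q 0.
have caseA p q n : mult_spec w p 2 -> mult_spec w q n -> (0 < n)%N ->
    mult_spec w (form3 0 0 1) 2 -> delta p q != 0 ->
    exists c0 c1 c2 : 'I_3 -> C, [/\ c0 0 * (c1 1 * c2 2 - c1 2 * c2 1)
    - c1 0 * (c0 1 * c2 2 - c0 2 * c2 1) + c2 0 * (c0 1 * c1 2 - c0 2 * c1 1) != 0,
    sing2 w c0, sing2 w c1 & sing w c2].
  move=> [_ _ /(_ isT) sp] [_ sq _] n_gt0 [_ _ /(_ isT) se] pq.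
  exists (form3 0 0 1), p, q; split=> //; last exact: sq.
  by rewrite (_ : _ + _ = delta p q) // /form3 /= /delta; ring.
have caseB p q n : mult_spec w p 2 -> mult_spec w q 2 -> mult_spec w (form3 0 0 1) n ->
    (0 < n)%N -> delta p q != 0 ->
    exists c0 c1 c2 : 'I_3 -> C, [/\ c0 0 * (c1 1 * c2 2 - c1 2 * c2 1)
    - c1 0 * (c0 1 * c2 2 - c0 2 * c2 1) + c2 0 * (c0 1 * c1 2 - c0 2 * c1 1) != 0,
    sing2 w c0, sing2 w c1 & sing w c2].
  move=> [_ _ /(_ isT) sp] [_ _ /(_ isT) sq] [_ se _] n_gt0 pq.
  exists p, q, (form3 0 0 1); split=> //; last exact: se.
  by rewrite (_ : _ + _ = delta p q) // /form3 /= /delta; ring.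
have deltaC p q : delta p q != 0 -> delta q p != 0.
  by rewrite -oppr_eq0 (_ : - _ = delta q p) // /delta; ring.
have d01 : delta (form3 0 1 0) (form3 1 0 0) != 0.
  by rewrite (_ : delta _ _ = -1) ?oppr_eq0 ?oner_neq0 // /delta /form3 /=; ring.
have d0x x : delta (form3 0 1 0) (contr_pt b x) != 0.
  by rewrite (_ : delta _ _ = -1) ?oppr_eq0 ?oner_neq0 // /delta /contr_pt /form3 /=; ring.
have d1x x : x != 0 -> delta (form3 1 0 0) (contr_pt b x) != 0.
  by move=> x0; rewrite (_ : delta _ _ = x) // /delta /contr_pt /form3 /=; ring.
have d23 : delta (contr_pt b c) (contr_pt b d) != 0.
  rewrite (_ : delta _ _ = d - c) ?subr_eq0 1?eq_sym // /delta /contr_pt /form3 /=; ring.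
have d02 := d0x c; have d03 := d0x d; have d12 := d1x c c0; have d13 := d1x d d0.
have e01 := deltaC _ _ d01; have e02 := deltaC _ _ d02; have e03 := deltaC _ _ d03.
have e12 := deltaC _ _ d12; have e13 := deltaC _ _ d13; have e23 := deltaC _ _ d23.
have [b0 _ _] := s0; have [b1 _ _] := s1; have [b2 _ _] := s2.
have [b3 _ _] := s3; have [b4 _ _] := s4.
have all2 : mult_spec w (form3 0 1 0) 2 -> mult_spec w (form3 1 0 0) 2 ->
    mult_spec w (contr_pt b c) 2 ->
    exists c0 c1 c2 : 'I_3 -> C, [/\ c0 0 * (c1 1 * c2 2 - c1 2 * c2 1)
    - c1 0 * (c0 1 * c2 2 - c0 2 * c2 1) + c2 0 * (c0 1 * c1 2 - c0 2 * c1 1) != 0,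
    sing2 w c0, sing2 w c1 & sing w c2].
  move=> [_ _ /(_ isT) sp] [_ _ /(_ isT) sq] [_ /(_ isT) se _].
  exists (form3 0 1 0), (form3 1 0 0), (contr_pt b c); split=> //.
  rewrite (_ : _ + _ = - (c / (b + c))); last by rewrite /contr_pt /form3 /=; ring.
  by rewrite oppr_eq0 mulf_neq0 ?invr_eq0.
have all1 : mult_spec w (form3 0 1 0) 1 -> mult_spec w (form3 1 0 0) 1 ->
    mult_spec w (contr_pt b c) 1 -> mult_spec w (contr_pt b d) 1 ->
    mult_spec w (form3 0 0 1) 2 -> False.
  move=> [_ /(_ isT) t0 _] [_ /(_ isT) t1 _] [_ /(_ isT) t2 _] [_ /(_ isT) t3 _].
  move=> [_ _ /(_ isT) t4]; apply: (no_four_tangents fw c0 d0 cd _ t1 t0 t2 t3).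
  by apply: sing2_eq t4; apply: ord3_ind.
move: n4 n3 n2 n1 n0 b4 b3 b2 b1 b0 n8 s0 s1 s2 s3 s4.
(* The bounds leave finitely many exponent vectors, and [n8] discards most of them. *)
case=> [|[|[|//]]]; case=> [|[|[|//]]]; case=> [|[|[|//]]]; case=> [|[|[|//]]];
  case=> [|[|[|//]]] => _ _ _ _ _ n8; try discriminate n8;
  move=> s0 s1 s2 s3 s4;
  by [apply: caseB s0 s1 s4 _ d01 | apply: caseB s0 s2 s4 _ d02 | apply: caseB s0 s3 s4 _ d03
     |apply: caseB s1 s2 s4 _ d12 | apply: caseB s1 s3 s4 _ d13 | apply: caseB s2 s3 s4 _ d23
     |apply: caseA s0 s1 _ s4 d01 | apply: caseA s0 s2 _ s4 d02 | apply: caseA s0 s3 _ s4 d03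
     |apply: caseA s1 s2 _ s4 d12 | apply: caseA s1 s3 _ s4 d13 | apply: caseA s2 s3 _ s4 d23
     |apply: caseA s1 s0 _ s4 e01 | apply: caseA s2 s0 _ s4 e02 | apply: caseA s3 s0 _ s4 e03
     |apply: caseA s2 s1 _ s4 e12 | apply: caseA s3 s1 _ s4 e13 | apply: caseA s3 s2 _ s4 e23
     |apply: all2 s0 s1 s2 | case: (all1 s0 s1 s2 s3 s4)].
Qed.

(** Vanishing at the vertices removes the cubes. The radial linear parts at the first two vertices
    and the Euler relation then remove or pair the other terms, leaving four free coefficients. *)
Lemma normal_form (C : numFieldType) (w : triple C) : form2 w ->
  sing2 w (@axis C 0) -> sing2 w (@axis C 1) -> sing w (@axis C 2) ->
  exists p1 p2 q1 q2 : C, [/\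
    tnth w 0 = 'X_1 * 'X_2 * (p1%:MP * 'X_1 + p2%:MP * 'X_2),
    tnth w 1 = 'X_0 * 'X_2 * (q1%:MP * 'X_0 + q2%:MP * 'X_2) &
    tnth w 2 = - ('X_0 * 'X_1 * (q1%:MP * 'X_0 + p1%:MP * 'X_1 + (p2 + q2)%:MP * 'X_2))].
Proof.
move=> fw s0 s1 s2; have [hw _ ew] := fw.
have t0 i := sing_coef i fw s0.1; have t1 i := sing_coef i fw s1.1.
have t2 i := sing_coef i fw s2.
have b210 := double_eq0 (sing2_coef (i := 1) (j := 1) fw s0 isT isT).
have c201 := double_eq0 (sing2_coef (i := 2) (j := 2) fw s0 isT isT).
have bc := sing2_coef (i := 1) (j := 2) fw s0 isT isT.
have a120 := double_eq0 (sing2_coef (i := 0) (j := 0) fw s1 isT isT).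
have c021 := double_eq0 (sing2_coef (i := 2) (j := 2) fw s1 isT isT).
have ac := sing2_coef (i := 0) (j := 2) fw s1 isT isT.
rewrite /= !(mul0n, mul1n, muln1, addn0, add0n) in b210 c201 bc a120 c021 ac.
have a300 := t0 0; have b300 := t0 1; have c300 := t0 2.
have a030 := t1 0; have b030 := t1 1; have c030 := t1 2.
have a003 := t2 0; have b003 := t2 1; have c003 := t2 2.
rewrite /= !(mul0n, mul1n) in a300 b300 c300 a030 b030 c030 a003 b003 c003.
have a210 := euler_coef 3 1 0 ew; rewrite b300 !addr0 in a210.
have a201 := euler_coef 3 0 1 ew; rewrite c300 !addr0 in a201.
have b120 := euler_coef 1 3 0 ew; rewrite a030 addr0 add0r in b120.
have b021 := euler_coef 0 3 1 ew; rewrite c030 addr0 add0r in b021.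
have a111 := euler_coef 2 1 1 ew; rewrite -addrA bc addr0 in a111.
have b111 := euler_coef 1 2 1 ew; rewrite addrAC ac add0r in b111.
have a102 := euler_coef 2 0 2 ew; rewrite c201 !addr0 in a102.
have b012 := euler_coef 0 2 2 ew; rewrite c021 addr0 add0r in b012.
have c102 := euler_coef 1 0 3 ew; rewrite a003 addr0 add0r in c102.
have c012 := euler_coef 0 1 3 ew; rewrite b003 !add0r in c012.
have c111 : coef3 (tnth w 2) 1 1 1 = - (coef3 (tnth w 0) 0 1 2 + coef3 (tnth w 1) 1 0 2).
  by apply/eqP; rewrite -addr_eq0 addrC; apply/eqP; exact: euler_coef 1 1 2 ew.
have c210 : coef3 (tnth w 2) 2 1 0 = - coef3 (tnth w 1) 2 0 1.
  by apply/eqP; rewrite -addr_eq0 addrC bc.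
have c120 : coef3 (tnth w 2) 1 2 0 = - coef3 (tnth w 0) 0 2 1.
  by apply/eqP; rewrite -addr_eq0 addrC ac.
exists (coef3 (tnth w 0) 0 2 1), (coef3 (tnth w 0) 0 1 2).
exists (coef3 (tnth w 1) 2 0 1), (coef3 (tnth w 1) 1 0 2); split.
- rewrite {1}(cubicE (hw 0)) /cubic a300 a030 a003 a210 a201 a111 a102 a120 mpolyC0; ring.
- rewrite {1}(cubicE (hw 1)) /cubic b300 b030 b003 b210 b120 b021 b111 b012 mpolyC0; ring.
- rewrite {1}(cubicE (hw 2)) /cubic c300 c030 c003 c201 c021 c102 c012 c111 c210 c120.
  by rewrite mpolyC0 !mpolyCN mpolyCD; ring.
Qed.

(** * The closed form and the reduction of the degree *)

Lemma supported_unit_or_dvd (C : fieldType) (P : seq {mpoly C[3]}) g :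
  supported P g -> (forall p, p \in P -> ~ dvd p g) -> g \is a GRing.unit.
Proof.
case=> c [[|p Q] [cu QP ->]] Pg; first by rewrite big_nil mulr1.
case: (Pg p); first by apply: QP; rewrite inE eqxx.
by rewrite big_cons; apply/dvd_mull/dvd_mulr/dvd_refl.
Qed.

Lemma supported_dvd (C : fieldType) (P : seq {mpoly C[3]}) g h :
  (forall p, p \in P -> prime_elt p) -> supported P h -> dvd g h -> supported P g.
Proof.
move=> primeP Ph [q qE]; apply: (@strip_primes _ P g h (fun=> q) (fun=> 1)) => //.
  by move=> _; rewrite mulr1 qE.
by move=> f /(_ 0) [k kE]; apply/unitrP; exists k; rewrite [f * k]mulrC -kE.
Qed.

Definition cremona (C : fieldType) : triple C := [tuple 'X_1 * 'X_2; 'X_0 * 'X_2; 'X_0 * 'X_1].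

Lemma cremona_homog (C : fieldType) i : tnth (cremona C) i \is 2.-homog.
Proof. by move: i; apply: ord3_ind; rewrite (tnth_nth 0) /= homog_XX. Qed.

Lemma cremona_coprime (C : fieldType) : no_common_factor (cremona C).
Proof.
move=> g gs.
have g0 : dvd g ('X_1 * 'X_2) by have := gs 0; rewrite (tnth_nth 0).
have g1 : dvd g ('X_0 * 'X_2) by have := gs 1; rewrite (tnth_nth 0).
have g2 : dvd g ('X_0 * 'X_1) by have := gs 2; rewrite (tnth_nth 0).
pose P : seq {mpoly C[3]} := [:: 'X_1; 'X_2].
have Pg : supported P g.
  apply: supported_dvd g0 => [p|].
    by rewrite !inE => /orP[] /eqP ->; apply: prime_X.
  by apply: supported_mul; apply: supported_mem; rewrite !inE eqxx ?orbT.
apply: (supported_unit_or_dvd Pg) => p; rewrite !inE => /orP[] /eqP -> pg.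
  have := meval_dvd0 (dvd_trans pg g1) (s := form3 1 0 1).
  rewrite mevalM !mevalXU /form3 /= mulr1 => /(_ erefl) /eqP; exact/negP/oner_neq0.
have := meval_dvd0 (dvd_trans pg g2) (s := form3 1 1 0).
rewrite mevalM !mevalXU /form3 /= mulr1 => /(_ erefl) /eqP; exact/negP/oner_neq0.
Qed.

Lemma cremonaK (C : fieldType) i :
  tnth (comp_triple (cremona C) (cremona C)) i = ('X_0 * 'X_1 * 'X_2) * 'X_i.
Proof.
move: i; apply: ord3_ind; rewrite tnth_comp_triple (tnth_nth 0) /=
  rmorphM /= !comp_mpolyU !(tnth_nth 0) /=; ring.
Qed.

Definition normal_triple (C : fieldType) (p1 p2 q1 q2 : C) : triple C :=
  [tuple 'X_1 * 'X_2 * (p1%:MP * 'X_1 + p2%:MP * 'X_2);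
         'X_0 * 'X_2 * (q1%:MP * 'X_0 + q2%:MP * 'X_2);
         - ('X_0 * 'X_1 * (q1%:MP * 'X_0 + p1%:MP * 'X_1 + (p2 + q2)%:MP * 'X_2))].

Definition normal_den (C : fieldType) (p1 p2 q1 q2 : C) : {mpoly C[3]} :=
  'X_0 * 'X_1 * (q1%:MP * 'X_0 + q2%:MP * 'X_2) * (p1%:MP * 'X_1 + p2%:MP * 'X_2).

(** The quotient is [(z dx - x dz) / (x N)] plus [(z dy - y dz) / (y M)]. The summands are pulled
    back from forms in the single variables [x / z] and [y / z], hence closed. *)
Lemma normal_closed (C : fieldType) (p1 p2 q1 q2 : C) i j :
  let P := normal_triple p1 p2 q1 q2 in let Q := normal_den p1 p2 q1 q2 in
  (tnth P i)^`M(j) * Q - tnth P i * Q^`M(j) = (tnth P j)^`M(i) * Q - tnth P j * Q^`M(i).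
Proof.
move=> P Q; have dQ k : Q^`M(k) = ((0 == k)%:R * 'X_1 + 'X_0 * (1 == k)%:R)
    * (q1%:MP * 'X_0 + q2%:MP * 'X_2) * (p1%:MP * 'X_1 + p2%:MP * 'X_2)
    + 'X_0 * 'X_1 * ((q1%:MP * (0 == k)%:R + q2%:MP * (2 == k)%:R)
      * (p1%:MP * 'X_1 + p2%:MP * 'X_2)
    + (q1%:MP * 'X_0 + q2%:MP * 'X_2) * (p1%:MP * (1 == k)%:R + p2%:MP * (2 == k)%:R)).
  rewrite /Q /normal_den !(mderivM, mderivD, mderivC, mderivU).
  move: ('X_0) ('X_1) ('X_2) (p1%:MP) (p2%:MP) (q1%:MP) (q2%:MP) => x y z a b c d.
  move: ((0 == k)%:R) ((1 == k)%:R) ((2 == k)%:R) => e f g; ring.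
have d0 k : (tnth P 0)^`M(k) = ((1 == k)%:R * 'X_2 + 'X_1 * (2 == k)%:R)
    * (p1%:MP * 'X_1 + p2%:MP * 'X_2)
    + 'X_1 * 'X_2 * (p1%:MP * (1 == k)%:R + p2%:MP * (2 == k)%:R).
  rewrite (tnth_nth 0) /= !(mderivM, mderivD, mderivC, mderivU).
  by rewrite !mul0r !add0r.
have d1 k : (tnth P 1)^`M(k) = ((0 == k)%:R * 'X_2 + 'X_0 * (2 == k)%:R)
    * (q1%:MP * 'X_0 + q2%:MP * 'X_2)
    + 'X_0 * 'X_2 * (q1%:MP * (0 == k)%:R + q2%:MP * (2 == k)%:R).
  rewrite (tnth_nth 0) /= !(mderivM, mderivD, mderivC, mderivU).
  by rewrite !mul0r !add0r.
have d2 k : (tnth P 2)^`M(k) = - (((0 == k)%:R * 'X_1 + 'X_0 * (1 == k)%:R)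
    * (q1%:MP * 'X_0 + p1%:MP * 'X_1 + (p2%:MP + q2%:MP) * 'X_2)
    + 'X_0 * 'X_1 * (q1%:MP * (0 == k)%:R + p1%:MP * (1 == k)%:R
      + (p2%:MP + q2%:MP) * (2 == k)%:R)).
  rewrite (tnth_nth 0) /= mderivN !(mderivM, mderivD, mderivC, mderivU).
  by rewrite !mul0r !add0r mpolyCD.
have Pn k : tnth P k = nth 0 P k by rewrite (tnth_nth 0).
move: i j; apply: ord3_ind; apply: ord3_ind; rewrite ?d0 ?d1 ?d2 !dQ !Pn /= {d0 d1 d2 dQ Pn P};
  rewrite /Q /normal_den ?mpolyCD;
  move: ('X_0) ('X_1) ('X_2) (p1%:MP) (p2%:MP) (q1%:MP) (q2%:MP) => x y z a b c d; ring.
Qed.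

(** If [M] were 0, [x] would divide all coefficients; if [N] were 0, [y] would. *)
Lemma normal_coeffs (C : fieldType) (p1 p2 q1 q2 : C) :
  no_common_factor (normal_triple p1 p2 q1 q2) ->
  (p1 != 0) || (p2 != 0) /\ (q1 != 0) || (q2 != 0).
Proof.
move=> cw; split; rewrite -negb_and; apply/negP => /andP[/eqP e1 /eqP e2].
- have : ('X_0 : {mpoly C[3]}) \is a GRing.unit.
    apply: cw; apply: ord3_ind; rewrite (tnth_nth 0) /=.
    + by rewrite e1 e2 mpolyC0 !mul0r addr0 mulr0; apply: dvd0.
    + by do 2!apply: dvd_mulr; apply: dvd_refl.
    + by apply: dvdN; do 2!apply: dvd_mulr; apply: dvd_refl.
  by case/unit_mpoly => c c0 /(congr1 (meval (fun=> 0))); rewrite mevalXU mevalC => /esym /eqP;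
    rewrite (negPf c0).
- have : ('X_1 : {mpoly C[3]}) \is a GRing.unit.
    apply: cw; apply: ord3_ind; rewrite (tnth_nth 0) /=.
    + by do 2!apply: dvd_mulr; apply: dvd_refl.
    + by rewrite e1 e2 mpolyC0 !mul0r addr0 mulr0; apply: dvd0.
    + by apply: dvdN; apply: dvd_mulr; apply: dvd_mull; apply: dvd_refl.
  by case/unit_mpoly => c c0 /(congr1 (meval (fun=> 0))); rewrite mevalXU mevalC => /esym /eqP;
    rewrite (negPf c0).
Qed.

Lemma linear2_neq0 (C : fieldType) (u v : C) (i j : 'I_3) : i != j ->
  (u != 0) || (v != 0) -> u%:MP * 'X_i + v%:MP * 'X_j != 0 :> {mpoly C[3]}.
Proof.
move=> ij uv; apply/eqP => e; move: uv.
have ev s : u * s i + v * s j = 0.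
  by have := congr1 (meval s) e; rewrite mevalD !mevalM meval0 !mevalC !mevalXU.
have := ev (@axis C i); have := ev (@axis C j).
rewrite /axis !eqxx (negPf ij) eq_sym (negPf ij) !mulr1 !mulr0 addr0 add0r => -> ->.
by rewrite eqxx.
Qed.

Lemma normal_den_neq0 (C : fieldType) (p1 p2 q1 q2 : C) :
  (p1 != 0) || (p2 != 0) -> (q1 != 0) || (q2 != 0) -> normal_den p1 p2 q1 q2 != 0.
Proof.
move=> p0 q0; have X0 i := (prime_X C i).1.
by rewrite /normal_den !mulf_neq0 // linear2_neq0.
Qed.

Lemma normal_den_homog (C : fieldType) (p1 p2 q1 q2 : C) :
  normal_den p1 p2 q1 q2 \is 4.-homog.
Proof.
have L (u v : C) (i j : 'I_3) : (u%:MP * 'X_i + v%:MP * 'X_j : {mpoly C[3]}) \is 1.-homog.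
  by apply: dhomogD; rewrite homog_CM ?homog_X.
exact: (dhomogM (dhomogM (homog_XX C 0 1) (L _ _ _ _)) (L _ _ _ _)).
Qed.

(** In the chart [z = 1] the normal form is proportional to [dx / (x (q1 x + q2)) + dy / (y (p1 y +
    p2))]. Inverting [x] and [y] gives, up to sign, [dx / (q1 + q2 x) + dy / (p1 + p2 y)], with
    denominators of degree at most 1; this triple is its homogeneous form. *)
Definition reduced_triple (C : fieldType) (p1 p2 q1 q2 : C) : triple C :=
  [tuple - ('X_2 * (p1%:MP * 'X_2 + p2%:MP * 'X_1));
         - ('X_2 * (q1%:MP * 'X_2 + q2%:MP * 'X_0));
         p1%:MP * ('X_0 * 'X_2) + q1%:MP * ('X_1 * 'X_2) + (p2 + q2)%:MP * ('X_0 * 'X_1)].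

Lemma normal_cremona (C : fieldType) (p1 p2 q1 q2 : C) j :
  tnth (pullback_form (cremona C) (normal_triple p1 p2 q1 q2)) j =
  ('X_0 ^+ 2 * 'X_1 ^+ 2 * 'X_2) * tnth (reduced_triple p1 p2 q1 q2) j.
Proof.
have n0 : tnth (normal_triple p1 p2 q1 q2) 0 \mPo cremona C =
    'X_0 * 'X_2 * ('X_0 * 'X_1) * (p1%:MP * ('X_0 * 'X_2) + p2%:MP * ('X_0 * 'X_1)).
  by rewrite (tnth_nth 0) /= !(rmorphM, rmorphD) /= !comp_mpolyC !comp_mpolyU !(tnth_nth 0).
have n1 : tnth (normal_triple p1 p2 q1 q2) 1 \mPo cremona C =
    'X_1 * 'X_2 * ('X_0 * 'X_1) * (q1%:MP * ('X_1 * 'X_2) + q2%:MP * ('X_0 * 'X_1)).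
  by rewrite (tnth_nth 0) /= !(rmorphM, rmorphD) /= !comp_mpolyC !comp_mpolyU !(tnth_nth 0).
have n2 : tnth (normal_triple p1 p2 q1 q2) 2 \mPo cremona C =
    - ('X_1 * 'X_2 * ('X_0 * 'X_2) * (q1%:MP * ('X_1 * 'X_2) + p1%:MP * ('X_0 * 'X_2)
      + (p2 + q2)%:MP * ('X_0 * 'X_1))).
  rewrite (tnth_nth 0) /= rmorphN !(rmorphM, rmorphD) /= !comp_mpolyC !comp_mpolyU.
  by rewrite !(tnth_nth 0).
rewrite tnth_pullback sum3 n0 n1 n2; move: j; apply: ord3_ind;
  rewrite !(tnth_nth 0) /= !mderivM !mderivU /= mpolyCD;
  move: ('X_0) ('X_1) ('X_2) (p1%:MP) (p2%:MP) (q1%:MP) (q2%:MP) => x y z a b c d; ring.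
Qed.

Lemma prime_linear2 (C : fieldType) (u v : C) :
  (u != 0) || (v != 0) -> prime_elt (u%:MP * 'X_2 + v%:MP * 'X_1 : {mpoly C[3]}).
Proof.
rewrite (_ : _ + _ = linear_form (form3 0 v u)); last first.
  by rewrite linear_form3 mpolyC0; ring.
by case/orP => uv; [apply: (@prime_linear_form _ _ 2)|apply: (@prime_linear_form _ _ 1)].
Qed.

Lemma linear2_eval (C : fieldType) (u v : C) (i j : 'I_3) (s : 'I_3 -> C) :
  (u%:MP * 'X_i + v%:MP * 'X_j).@[s] = u * s i + v * s j.
Proof. by rewrite mevalD !mevalM !mevalC !mevalXU. Qed.

Lemma linear2_dvd (C : fieldType) (p1 p2 q1 q2 : C) : (q1 != 0) || (q2 != 0) ->
  dvd (p1%:MP * 'X_2 + p2%:MP * 'X_1 : {mpoly C[3]}) (q1%:MP * 'X_2 + q2%:MP * 'X_0) ->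
  p2 = 0 /\ q2 = 0.
Proof.
move=> q0 pq.
(* The points (x : p1 : - p2) all lie on the zero line of the divisor. *)
have ev x : q1 * - p2 + q2 * x = 0.
  have := meval_dvd0 pq (s := form3 x p1 (- p2)); rewrite !linear2_eval /form3 /=.
  by apply; ring.
have q2E : q2 = 0 by have := ev 1; have := ev 0; rewrite mulr0 addr0 => ->; rewrite add0r mulr1.
move: q0; rewrite q2E eqxx orbF => q1n; split=> //.
by have /eqP := ev 0; rewrite mulr0 addr0 mulf_eq0 (negPf q1n) oppr_eq0 => /eqP.
Qed.

(** The possible prime factors are those of the first coefficient, ['X_2] and [p1 z + p2 y]. The
    second can divide the second coefficient only if [p2 = 0]. Then both vanish at (1 : 1 : 0),
    where the third coefficient is [p2 + q2]. *)
Lemma reduced_coprime (C : fieldType) (p1 p2 q1 q2 : C) :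
  (p1 != 0) || (p2 != 0) -> (q1 != 0) || (q2 != 0) -> p2 + q2 != 0 ->
  no_common_factor (reduced_triple p1 p2 q1 q2).
Proof.
move=> p0 q0 pq g gr.
have r0 : dvd g ('X_2 * (p1%:MP * 'X_2 + p2%:MP * 'X_1)).
  by have := dvdN (gr 0); rewrite (tnth_nth 0) /= opprK.
have r1 : dvd g ('X_2 * (q1%:MP * 'X_2 + q2%:MP * 'X_0)).
  by have := dvdN (gr 1); rewrite (tnth_nth 0) /= opprK.
have r2 (s : 'I_3 -> C) : g.@[s] = 0 ->
    p1 * (s 0 * s 2) + q1 * (s 1 * s 2) + (p2 + q2) * (s 0 * s 1) = 0.
  have := gr 2; rewrite (tnth_nth 0) /= => /meval_dvd0 H /H.
  by rewrite !(mevalD, mevalM, mevalC, mevalXU).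
have primeP p : p \in [:: 'X_2; p1%:MP * 'X_2 + p2%:MP * 'X_1] -> prime_elt p.
  by rewrite !inE => /orP[] /eqP ->; [apply: prime_X|apply: prime_linear2].
apply: (@supported_unit_or_dvd _ [:: 'X_2; p1%:MP * 'X_2 + p2%:MP * 'X_1]).
  apply: supported_dvd r0 => //.
  by apply: supported_mul; apply: supported_mem; rewrite !inE eqxx ?orbT.
have X2g : ~ dvd 'X_2 g.
  move=> zg; have := r2 (form3 1 1 0); rewrite /form3 /= !mulr0 !add0r !mulr1 => H.
  by move/eqP: pq; apply; apply: H; apply: (meval_dvd0 zg); rewrite mevalXU.
move=> p; rewrite !inE => /orP[] /eqP -> // mg.
have p2E : p2 = 0.
  have [/(@meval_dvd0 _ _ _ (form3 0 p1 (- p2)))|/(linear2_dvd q0)[] //] :=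
    (prime_linear2 p0).2 _ _ (dvd_trans mg r1).
  rewrite linear2_eval mevalXU /form3 /= => H; apply/eqP; rewrite -oppr_eq0.
  by apply/eqP/H; ring.
have := r2 (form3 1 1 0); rewrite /form3 /= !mulr0 !add0r !mulr1 => H.
move/eqP: pq; apply; apply: H; apply: (meval_dvd0 mg).
by rewrite linear2_eval p2E /form3 /=; ring.
Qed.

(** For [q2 = - p2] the reduced form is divisible by ['X_2]; this is the quotient, which defines a
    foliation of degree 0. *)
Lemma reduced_coprime0 (C : fieldType) (p1 p2 q1 : C) :
  (p1 != 0) || (p2 != 0) -> (q1 != 0) || (- p2 != 0) ->
  no_common_factor [tuple - (p1%:MP * 'X_2 + p2%:MP * 'X_1);
    - (q1%:MP * 'X_2 + (- p2)%:MP * 'X_0); p1%:MP * 'X_0 + q1%:MP * 'X_1].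
Proof.
move=> p0 q0 g gr.
have r0 : dvd g (p1%:MP * 'X_2 + p2%:MP * 'X_1).
  by have := dvdN (gr 0); rewrite (tnth_nth 0) /= opprK.
have r1 : dvd g (q1%:MP * 'X_2 + (- p2)%:MP * 'X_0).
  by have := dvdN (gr 1); rewrite (tnth_nth 0) /= opprK.
have r2 : dvd g (p1%:MP * 'X_0 + q1%:MP * 'X_1).
  by have := gr 2; rewrite (tnth_nth 0).
apply: (@supported_unit_or_dvd _ [:: p1%:MP * 'X_2 + p2%:MP * 'X_1]).
  apply: supported_dvd r0 => [p|]; last by apply: supported_mem; rewrite inE eqxx.
  by rewrite inE => /eqP ->; apply: prime_linear2.
move=> p; rewrite inE => /eqP -> mg.
have [p2E _] := linear2_dvd q0 (dvd_trans mg r1).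
have := meval_dvd0 (dvd_trans mg r2) (s := form3 0 1 0).
rewrite !linear2_eval /form3 /= !mulr0 !add0r !mulr1 => /(_ p2E) q1E.
by move: q0; rewrite q1E p2E oppr0 eqxx.
Qed.

Lemma homog_linear2 (C : fieldType) (u v : C) (i j : 'I_3) :
  (u%:MP * 'X_i + v%:MP * 'X_j : {mpoly C[3]}) \is 1.-homog.
Proof. by apply: dhomogD; rewrite homog_CM ?homog_X. Qed.

Lemma reduced_foliation (C : fieldType) (p1 p2 q1 q2 : C) :
  (p1 != 0) || (p2 != 0) -> (q1 != 0) || (q2 != 0) ->
  exists (G : foliation C) (g : {mpoly C[3]}), [/\ (fol_deg G < 2)%N, g != 0 &
    forall j, tnth (reduced_triple p1 p2 q1 q2) j = g * tnth (fol_form G) j].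
Proof.
move=> p0 q0; have [pq|pq] := eqVneq (p2 + q2) 0; last first.
  have hr i : tnth (reduced_triple p1 p2 q1 q2) i \is 2.-homog.
    move: i; apply: ord3_ind; rewrite (tnth_nth 0) /= ?dhomogN.
    - exact: (dhomogM (homog_X C 2) (homog_linear2 _ _ _ _)).
    - exact: (dhomogM (homog_X C 2) (homog_linear2 _ _ _ _)).
    - by do 2?[apply: dhomogD]; rewrite homog_CM ?homog_XX.
  have er : \sum_(i < 3) 'X_i * tnth (reduced_triple p1 p2 q1 q2) i = 0.
    rewrite sum3 !(tnth_nth 0) /= mpolyCD.
    move: ('X_0) ('X_1) ('X_2) (p1%:MP) (p2%:MP) (q1%:MP) (q2%:MP) => x y z a b c d; ring.
  exists (@Foliation C 1 _ hr (reduced_coprime p0 q0 pq) er), 1; split=> //.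
    exact: oner_neq0.
  by move=> j; rewrite mul1r.
have q2E : q2 = - p2 by apply/eqP; rewrite -addr_eq0 addrC pq.
rewrite q2E in q0 *.
set r : triple C := [tuple - (p1%:MP * 'X_2 + p2%:MP * 'X_1);
    - (q1%:MP * 'X_2 + (- p2)%:MP * 'X_0); p1%:MP * 'X_0 + q1%:MP * 'X_1].
have hr i : tnth r i \is 1.-homog.
  by move: i; apply: ord3_ind; rewrite (tnth_nth 0) /= ?dhomogN homog_linear2.
have er : \sum_(i < 3) 'X_i * tnth r i = 0.
  rewrite sum3 !(tnth_nth 0) /= mpolyCN.
  move: ('X_0) ('X_1) ('X_2) (p1%:MP) (p2%:MP) (q1%:MP) => x y z a b c; ring.
exists (@Foliation C 0 _ hr (reduced_coprime0 p0 q0) er), 'X_2; split=> //.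
  exact: (prime_X C 2).1.
by apply: ord3_ind; rewrite !(tnth_nth 0) /= ?subrr ?mpolyC0; ring.
Qed.

Lemma cremona_birational (C : fieldType) (N : 'M[C]_3) : N \in unitmx ->
  exists2 f : rational_map C, birational f &
    rat_coord f = comp_triple (linear_triple N) (cremona C).
Proof.
move=> Nu.
have compE i : tnth (comp_triple (linear_triple N) (cremona C)) i =
    \sum_(j < 3) N i j *: tnth (cremona C) j.
  by rewrite tnth_comp_triple tnth_linear; apply: linear_form_comp.
have hf i : tnth (comp_triple (linear_triple N) (cremona C)) i \is 2.-homog.
  by rewrite compE; apply: rpred_sum => j _; apply/rpredZ/cremona_homog.
have cf := no_common_factor_linear_comb Nu compE (@cremona_coprime C).
have Nu' : invmx N \in unitmx by rewrite unitmx_inv.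
have hg i : tnth (comp_triple (cremona C) (linear_triple (invmx N))) i \is 2.-homog.
  by rewrite tnth_comp_triple; apply: (comp_homog (cremona_homog C i) (linear_homog _)).
have cg := no_common_factor_comp_linear Nu' (@cremona_coprime C).
exists (RationalMap hf cf) => //; exists (RationalMap hg cg); split => /=.
  exists ('X_0 * 'X_1 * 'X_2); first by rewrite !mulf_neq0 // (prime_X C _).1.
  move=> i; rewrite comp_tripleA -[comp_triple (linear_triple _) _]comp_tripleA.
  by rewrite linear_comp mulVmx // linear1 comp_id_triple cremonaK.
exists (('X_0 * 'X_1 * 'X_2) \mPo linear_triple (invmx N)).
  apply/eqP => e; have := linear_compVK ('X_0 * 'X_1 * 'X_2) Nu; rewrite e comp_mpoly0.
  by move/esym/eqP; apply/negP; rewrite !mulf_neq0 // (prime_X C _).1.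
move=> i; rewrite -comp_tripleA [comp_triple (comp_triple (linear_triple N) _) _]comp_tripleA.
rewrite tnth_comp_triple tnth_comp_triple tnth_linear.
rewrite -/(linear_form (fun j => N i j)) linear_form_comp.
under eq_bigr => j _ do rewrite cremonaK scalerAr.
rewrite -mulr_sumr rmorphM /=; congr (_ * _).
have e : tnth (comp_triple (linear_triple N) (linear_triple (invmx N))) i = 'X_i.
  by rewrite linear_comp mulmxV // linear1 tnth_mktuple.
by rewrite -[RHS]e tnth_comp_triple tnth_linear.
Qed.

Lemma foliation_form2 (C : fieldType) (F : foliation C) :
  fol_deg F = 2%N -> form2 (fol_form F).
Proof.
case: F => d w hw cw ew /= d2; rewrite d2 in hw *; by split.
Qed.

Lemma normal_conclusion (C : fieldType) (F : foliation C) (N : 'M[C]_3) (p1 p2 q1 q2 : C) :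
  fol_deg F = 2%N -> N \in unitmx ->
  pullback_form (linear_triple N) (fol_form F) = normal_triple p1 p2 q1 q2 ->
  (exists theta : rational_form C,
     [/\ rform_nonzero theta, rform_closed theta & rform_defines theta F]) /\
  (exists2 f : rational_map C, birational f &
     exists2 G : foliation C, is_pullback f F G & (fol_deg G < fol_deg F)%N).
Proof.
move=> F2 Nu wN; have fw := foliation_form2 F2; have [hw cw ew] := fw.
have [_ cN _] := form2_linear Nu fw; rewrite wN in cN.
have [p0 q0] := normal_coeffs cN; split.
  set w := fol_form F in fw hw cw ew wN *.
  (* The denominator of the closed form, carried back to the original coordinates; the numerator is
     omega itself. *)
  pose Q := normal_den p1 p2 q1 q2 \mPo linear_triple (invmx N).
  have hQ : Q \is 4.-homog.
    exact: (comp_homog (normal_den_homog p1 p2 q1 q2) (linear_homog _)).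
  have Q0 : Q != 0.
    apply/eqP => Q0; move/eqP: (normal_den_neq0 p0 q0); apply.
    by rewrite -(linear_compVK (normal_den p1 p2 q1 q2) Nu) -/Q Q0 comp_mpoly0.
  exists (RationalForm hw hQ Q0 ew); split.
  - by exists 2; apply: contact_neq0.
  - move=> i j /=; have := closed_linear (invmx N) (normal_closed p1 p2 q1 q2) i j.
    by rewrite -wN pullback_linearK.
  - by move=> i j; rewrite mulrC.
have [f fbir fE] := cremona_birational Nu.
have [G [g [G2 g0 Gg]]] := reduced_foliation p0 q0.
exists f => //; exists G; last by rewrite F2.
exists ('X_0 ^+ 2 * 'X_1 ^+ 2 * 'X_2 * g).
  by rewrite !mulf_neq0 ?expf_neq0 // (prime_X C _).1.
by move=> j; rewrite fE pullback_comp wN normal_cremona Gg mulrA.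
Qed.

(** The automorphism [l] is absorbed in [F] and [l'] in [G], without change of degree, so that only
    [Phi] has to be studied. *)
Lemma cubic_invariant (C : numFieldType) (a b c d : C) (l l' : 'M[C]_3)
    (phi : rational_map C) (F G : foliation C) :
  c + d = - a -> c * d = 1 -> c != d -> b + c != 0 -> b + d != 0 ->
  l \in unitmx -> l' \in unitmx ->
  rat_coord phi =
    comp_triple (linear_triple l) (comp_triple (Phi a b) (linear_triple l')) ->
  fol_deg F = 2%N -> fol_deg G = 2%N -> is_pullback phi F G ->
  exists N p1 p2 q1 q2, N \in unitmx /\
    pullback_form (linear_triple N) (fol_form F) = normal_triple p1 p2 q1 q2.
Proof.
move=> cd1 cd2 cd bc bd lu l'u phiE F2 G2 [g _ WG].
have fw := form2_linear lu (foliation_form2 F2).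
set w := pullback_form _ _ in fw.
have [hG _ _] := foliation_form2 G2.
have he j : tnth (pullback_form (linear_triple (invmx l')) (fol_form G)) j \is 3.-homog.
  rewrite tnth_pullback_linear; apply: rpred_sum => i _; apply: rpredZ.
  exact: (comp_homog (hG i) (linear_homog _)).
have We j : tnth (pullback_form (Phi a b) w) j = (g \mPo linear_triple (invmx l'))
    * tnth (pullback_form (linear_triple (invmx l')) (fol_form G)) j.
  rewrite -(pullbackZ _ WG) phiE pullback_comp pullback_comp.
  by rewrite pullback_linearK.
have [n0 [n1 [n2 [n3 [n4 [s0 s1 [s2 s3] s4 n8]]]]]] :=
  mult_spec_all cd1 cd2 cd bc bd fw he We.
have c0 : c != 0 by apply: contraTneq (oner_neq0 C) => c0; rewrite -cd2 c0 mul0r eqxx.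
have d0 : d != 0 by apply: contraTneq (oner_neq0 C) => d0; rewrite -cd2 d0 mulr0 eqxx.
have [v0 [v1 [v2 [/mx3_unit Mu t0 t1 t2]]]] := three_points fw c0 d0 cd bc s0 s1 s2 s3 s4 n8.
set M := mx3 v0 v1 v2 in Mu.
have colE : [/\ v0 =1 (fun i => M i 0), v1 =1 (fun i => M i 1) & v2 =1 (fun i => M i 2)].
  by split=> i; rewrite mxE.
have [E0 E1 E2] := colE.
have [p1 [p2 [q1 [q2 [e0 e1 e2]]]]] := normal_form (form2_linear Mu fw)
  (sing2_col (sing2_eq E0 t0)) (sing2_col (sing2_eq E1 t1)) (sing_col (sing_eq E2 t2)).
exists (l *m M), p1, p2, q1, q2; split; first by rewrite unitmx_mul lu.
rewrite -linear_comp pullback_comp.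
by apply: eq_from_tnth; apply: ord3_ind; rewrite ?e0 ?e1 ?e2 (tnth_nth 0).
Qed.

Theorem theorem3 (R : realType) (a b : R[i]) (l l' : 'M[R[i]]_3)
    (phi : rational_map R[i]) (F : foliation R[i]) :
  a ^+ 2 != 4 ->
  2 * b \notin [:: a + sqrtC (a ^+ 2 - 4); a - sqrtC (a ^+ 2 - 4)] ->
  l \in unitmx -> l' \in unitmx ->
  birational phi ->
  (* l runs over GL_3, which absorbs the scalar in the choice of coordinates *)
  rat_coord phi =
    comp_triple (linear_triple l) (comp_triple (Phi a b) (linear_triple l')) ->
  fol_deg F = 2%N ->
  (exists2 G : foliation R[i], is_pullback phi F G & fol_deg G = 2%N) ->
  (exists theta : rational_form R[i],
     [/\ rform_nonzero theta, rform_closed theta & rform_defines theta F]) /\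
  (exists2 varphi : rational_map R[i], birational varphi &
     exists2 G : foliation R[i], is_pullback varphi F G &
       (fol_deg G < fol_deg F)%N).
Proof.
move=> a4 b2 lu l'u _ phiE F2 [G FG G2].
(* The roots [c] and [d] are [(- a + r) / 2] and [(- a - r) / 2]. The excluded values [a - r] and
   [a + r] of [2 * b] correspond to [b + c = 0] and [b + d = 0]. *)
pose r : R[i] := sqrtC (a ^+ 2 - 4).
have r2 : r ^+ 2 = a ^+ 2 - 4 by rewrite sqrtCK.
have r0 : r != 0 by rewrite sqrtC_eq0 subr_eq0.
have two0 : (2 : R[i]) != 0 by rewrite pnatr_eq0.
move: b2; rewrite !inE negb_or -/r => /andP[bp bm].
have cd1 : (- a + r) / 2 + (- a - r) / 2 = - a by field.
have cd2 : (- a + r) / 2 * ((- a - r) / 2) = 1.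
  rewrite (_ : _ * _ = (a ^+ 2 - r ^+ 2) / 4); last by field.
  by rewrite r2; field.
have cd : (- a + r) / 2 != (- a - r) / 2.
  have e : (- a + r) / 2 - (- a - r) / 2 = r by field.
  by rewrite -subr_eq0 e.
have bc : b + (- a + r) / 2 != 0.
  apply: contra bm => /eqP e; rewrite -subr_eq0.
  have e2 : 2 * b - (a - r) = 2 * (b + (- a + r) / 2) by field.
  by rewrite e2 e mulr0.
have bd : b + (- a - r) / 2 != 0.
  apply: contra bp => /eqP e; rewrite -subr_eq0.
  have e2 : 2 * b - (a + r) = 2 * (b + (- a - r) / 2) by field.
  by rewrite e2 e mulr0.
have [N [p1 [p2 [q1 [q2 [Nu wN]]]]]] :=
  cubic_invariant cd1 cd2 cd bc bd lu l'u phiE F2 G2 FG.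
exact: normal_conclusion F2 Nu wN.
Qed.
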